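(* Let $S$ be a $3$-dimensional quantum polynomial algebra determined by a symmetric regular superpotential, i.e. $S$ is one of the algebras $\mathcal{S}$, $\mathcal{S}'$, $\mathcal{N}$, or $\mathcal{E}_\xi$ with $\xi$ any admissible scalar. Let $(a,b,c),(a',b',c')\in k^3\setminus\{0\}$. Then $$(S,\,ax^2+by^2+cz^2)\cong(S,\,a'x^2+b'y^2+c'z^2)$$ if and only if there is $\varphi\in\operatorname{GrAut}S$ such that $$\begin{pmatrix}a'\\ b'\\ c'\end{pmatrix}=\varphi\begin{pmatrix}a\\ b\\ c\end{pmatrix}.$$
   Context: Let $k$ be an algebraically closed field of characteristic zero. A $3$-dimensional quantum polynomial algebra is a noetherian connected graded $k$-algebra $S$ of global dimension $3$ with $\operatorname{Ext}^i_S(k,S)\cong k$ for $i=3$ and $0$ for $i\neq3$, and with Hilbert series $(1-t)^{-3}$. Let $V$ be the vector space with basis $x,y,z$. For $\omega\in V^{\otimes3}$ write uniquely $\omega=x\otimes\omega_x+y\otimes\omega_y+z\otimes\omega_z$ with $\omega_x,\omega_y,\omega_z\in V^{\otimes2}$. The derivation-quotient algebra of $\omega$ is $\mathcal{D}(\omega)=T(V)/(\omega_x,\omega_y,\omega_z)$. A superpotential is an $\omega$ invariant under the cyclic permutation of the tensor factors. It is regular if $\mathcal{D}(\omega)$ is a quantum polynomial algebra, and symmetric if it is invariant under all permutations of the three tensor factors. The algebra determined by $\omega$ is $\mathcal{D}(\omega)$. Call $\xi\in k$ admissible if $\xi\neq0$, $\xi\neq-2$, $\xi\neq1\pm\sqrt{-3}$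 and $\xi^3\neq1$. Up to linear change of variables, the algebras determined by symmetric regular superpotentials are the following, with $x,y,z$ of degree $1$: $$\mathcal{S}=k\langle x,y,z\rangle/(xy+yx,\ yz+zy,\ zx+xz),$$ $$\mathcal{S}'=k\langle x,y,z\rangle/(xy+yx,\ yz+zy+x^2,\ zx+xz),$$ $$\mathcal{N}=k\langle x,y,z\rangle/(xy+yx,\ yz+zy+x^2,\ zx+xz+y^2),$$ $$\mathcal{E}_\xi=k\langle x,y,z\rangle/(xy+yx+\xi z^2,\ yz+zy+\xi x^2,\ zx+xz+\xi y^2)\quad(\xi\text{ admissible}).$$ In each of them the central elements of degree $2$ are exactly the elements $ax^2+by^2+cz^2$ with $a,b,c\in k$, and every nonzero such element is regular. Two pairs $(S,f)$, $(S',f')$, with $f\in S_2$ and $f'\in S'_2$ central regular, are isomorphic, written $(S,f)\cong(S',f')$, if there is an isomorphism of graded algebras $\psi:S\to S'$ with $\psi(f)=f'$. $\operatorname{GrAut}S$ is the group of graded algebra automorphisms of $S$. An element of $\operatorname{GrAut}S$ is identified with the invertible $3\times3$ matrix describing its action on the degree-one part $S_1$ with respect to the basis $x,y,z$, and this matrix acts on column vectors in $k^3$ in the usual way. *)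

(* Defs.v *)
From HB Require Import structures.
From mathcomp Require Import all_boot all_order all_algebra.
From mathcomp Require Import boolp.
From mathcomp Require Export monalg.

Set Implicit Arguments.
Unset Strict Implicit.
Unset Printing Implicit Defensive.

Import GRing.Theory.
Local Open Scope ring_scope.
Local Open Scope quotient_scope.

Section QuotientAlgebra.
Variables (k : pzRingType) (A : lalgType k) (rels : seq A).

Definition in_ideal (u : A) : Prop :=
  exists s : seq (A * 'I_(size rels) * A),
    u = \sum_(t <- s) t.1.1 * rels`_(t.1.2) * t.2.

Definition ideal : {pred A} := fun u => `[< in_ideal u >].

Lemma idealP u : reflect (in_ideal u) (u \in ideal).
Proof. exact: asboolP. Qed.

Lemma ideal_mull a u : u \in ideal -> a * u \in ideal.
Proof.
move=> /idealP[s ->]; apply/idealP.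
exists [seq (a * t.1.1, t.1.2, t.2) | t <- s].
by rewrite big_map mulr_sumr; apply: eq_bigr => t _; rewrite !mulrA.
Qed.

Lemma ideal_mulr a u : u \in ideal -> u * a \in ideal.
Proof.
move=> /idealP[s ->]; apply/idealP.
exists [seq (t.1.1, t.1.2, t.2 * a) | t <- s].
by rewrite big_map mulr_suml; apply: eq_bigr => t _; rewrite !mulrA.
Qed.

Lemma ideal_scale c u : u \in ideal -> c *: u \in ideal.
Proof. by move=> Iu; rewrite -[u]mul1r scalerAl ideal_mull. Qed.

Lemma ideal_zmod_closed : zmod_closed ideal.
Proof.
split=> [|u v /idealP[s ->] /(ideal_mull (-1)) /idealP[t vE]].
  by apply/idealP; exists [::]; rewrite big_nil.
by apply/idealP; exists (s ++ t); rewrite big_cat /= -vE mulN1r.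
Qed.

HB.instance Definition _ := GRing.isZmodClosed.Build A ideal ideal_zmod_closed.

Definition quotalg : Type := Quotient.quot ideal.
HB.instance Definition _ := GRing.Zmodule.on quotalg.

Definition qproj (u : A) : quotalg := \pi_(Quotient.quot ideal) u.

Lemma qproj_eq u v : (qproj u == qproj v) = (u - v \in ideal).
Proof. by rewrite (Quotient.idealrBE ideal). Qed.

Lemma qproj_surj (q : quotalg) : exists u, qproj u = q.
Proof. by exists (repr q); rewrite /qproj reprK. Qed.

Lemma qproj_is_zmod_morphism : zmod_morphism qproj.
Proof. by move=> u v; rewrite /qproj raddfB. Qed.

HB.instance Definition _ :=
  GRing.isZmodMorphism.Build A quotalg qproj qproj_is_zmod_morphism.

Definition qrepr (q : quotalg) : A := repr (q : Quotient.quot ideal).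

Lemma qreprK q : qproj (qrepr q) = q.
Proof. exact: reprK. Qed.

Lemma qreprB u : u - qrepr (qproj u) \in ideal.
Proof. by rewrite -qproj_eq qreprK. Qed.

Definition qone : quotalg := qproj 1.
Definition qmul (p q : quotalg) : quotalg := qproj (qrepr p * qrepr q).
Definition qscale (c : k) (q : quotalg) : quotalg := qproj (c *: qrepr q).

Lemma qproj_mul u v : qproj (u * v) = qmul (qproj u) (qproj v).
Proof.
apply/eqP; rewrite qproj_eq.
rewrite -[u * v](subrK (u * qrepr (qproj v))) -mulrBr -addrA -mulrBl.
by apply: rpredD; [apply: ideal_mull | apply: ideal_mulr]; exact: qreprB.
Qed.

Lemma qproj_scale c u : qproj (c *: u) = qscale c (qproj u).
Proof.
by apply/eqP; rewrite qproj_eq -scalerBr ideal_scale ?qreprB.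
Qed.

Lemma qmulA : associative qmul.
Proof.
by move=> p q r; rewrite -[p]qreprK -[q]qreprK -[r]qreprK -!qproj_mul mulrA.
Qed.

Lemma qmul1 : left_id qone qmul.
Proof. by move=> p; rewrite -[p]qreprK -qproj_mul mul1r. Qed.

Lemma qmulr1 : right_id qone qmul.
Proof. by move=> p; rewrite -[p]qreprK -qproj_mul mulr1. Qed.

Lemma qmulDl : left_distributive qmul +%R.
Proof.
move=> p q r; rewrite -[p]qreprK -[q]qreprK -[r]qreprK.
by rewrite -!qproj_mul -!raddfD -qproj_mul mulrDl.
Qed.

Lemma qmulDr : right_distributive qmul +%R.
Proof.
move=> p q r; rewrite -[p]qreprK -[q]qreprK -[r]qreprK.
by rewrite -!qproj_mul -!raddfD -qproj_mul mulrDr.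
Qed.

HB.instance Definition _ :=
  GRing.Zmodule_isPzRing.Build quotalg qmulA qmul1 qmulr1 qmulDl qmulDr.

Lemma qscaleA a b q : qscale a (qscale b q) = qscale (a * b) q.
Proof. by rewrite -[q]qreprK -!qproj_scale scalerA. Qed.

Lemma qscale1 : left_id 1 qscale.
Proof. by move=> q; rewrite -[q]qreprK -qproj_scale scale1r. Qed.

Lemma qscaleDr : right_distributive qscale +%R.
Proof.
move=> c p q; rewrite -[p]qreprK -[q]qreprK.
by rewrite -raddfD -!qproj_scale -raddfD scalerDr.
Qed.

Lemma qscaleDl q : {morph qscale^~ q : a b / a + b}.
Proof.
by move=> a b; rewrite -[q]qreprK -!qproj_scale -raddfD scalerDl.
Qed.

HB.instance Definition _ :=
  GRing.Zmodule_isLmodule.Build k quotalg qscaleA qscale1 qscaleDr qscaleDl.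

Lemma qscaleAl c (p q : quotalg) : c *: (p * q) = c *: p * q.
Proof.
rewrite -[p]qreprK -[q]qreprK.
rewrite -[X in c *: X]qproj_mul -[LHS]qproj_scale.
by rewrite -[X in _ = X * _]qproj_scale -[RHS]qproj_mul scalerAl.
Qed.

Lemma qproj_is_scalable : scalable qproj.
Proof. exact: qproj_scale. Qed.

Lemma qproj_is_monoid_morphism : monoid_morphism qproj.
Proof. by split=> // u v; exact: qproj_mul. Qed.

HB.instance Definition _ :=
  GRing.isScalable.Build k A quotalg *:%R qproj qproj_is_scalable.
HB.instance Definition _ :=
  GRing.isMonoidMorphism.Build A quotalg qproj qproj_is_monoid_morphism.

End QuotientAlgebra.

(* k<x, y, z>, as the algebra of the free monoid on 'I_3. *)
Notation freealg k := {malg k[{fmonom 'I_3}]}.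

Definition fgen (k : closedFieldType) (i : 'I_3) : freealg k := << fmu i >>.

Definition admissible (k : closedFieldType) (xi : k) : Prop :=
  [/\ xi != 0, xi != - 2%:R,
      forall s : k, s ^+ 2 = - 3%:R -> xi != 1 + s /\ xi != 1 - s
    & xi ^+ 3 != 1].

Inductive symm_kind (k : closedFieldType) : Type :=
| kind_S
| kind_S'
| kind_N
| kind_E (xi : k) of admissible xi.

Definition symm_rels (k : closedFieldType) (K : symm_kind k) :
    seq (freealg k) :=
  let x := fgen k 0 in let y := fgen k 1 in let z := fgen k 2%:R in
  match K with
  | kind_S => [:: x * y + y * x; y * z + z * y; z * x + x * z]
  | kind_S' => [:: x * y + y * x; y * z + z * y + x ^+ 2; z * x + x * z]
  | kind_N =>
      [:: x * y + y * x; y * z + z * y + x ^+ 2; z * x + x * z + y ^+ 2]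
  | kind_E xi _ =>
      [:: x * y + y * x + xi *: z ^+ 2; y * z + z * y + xi *: x ^+ 2;
          z * x + x * z + xi *: y ^+ 2]
  end.

Section SymmetricAlgebra.
Variables (k : closedFieldType) (K : symm_kind k).

Definition symm_alg : Type := quotalg (symm_rels K).
HB.instance Definition _ := GRing.PzRing.on symm_alg.
HB.instance Definition _ := GRing.Lmodule.on symm_alg.

Let coef1 : freealg k -> k := mcoeff (mone : {fmonom 'I_3}).

Let coef1D u v : coef1 (u + v) = coef1 u + coef1 v.
Proof. exact: raddfD. Qed.

Let coef1Z c u : coef1 (c *: u) = c * coef1 u.
Proof. exact: mcoeffZ. Qed.

Let coef1M u v : coef1 (u * v) = coef1 u * coef1 v.
Proof. exact: rmorphM. Qed.

Let coef1_fgen i : coef1 (fgen k i) = 0.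
Proof. by rewrite /coef1 mcoeffU1 fm1_eq1. Qed.

Lemma symm_rels_coef1 r : r \in symm_rels K -> coef1 r = 0.
Proof.
have MM i j : coef1 (fgen k i * fgen k j) = 0.
  by rewrite coef1M coef1_fgen mul0r.
have DD i j l m : coef1 (fgen k i * fgen k j + fgen k l * fgen k m) = 0.
  by rewrite coef1D (MM i j) (MM l m) addr0.
have ZZ c i j l m n :
    coef1 (fgen k i * fgen k j + fgen k l * fgen k m + c *: fgen k n ^+ 2) = 0.
  by rewrite coef1D coef1Z (DD i j l m) expr2 (MM n n) mulr0 addr0.
have SS i j l m n :
    coef1 (fgen k i * fgen k j + fgen k l * fgen k m + fgen k n ^+ 2) = 0.
  by rewrite -[fgen k n ^+ 2]scale1r.
case: K => [|||xi adm_xi]; rewrite /symm_rels;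
  case/predU1P=> [->|/predU1P[->|/predU1P[->|//]]].
- exact: DD. - exact: DD. - exact: DD.
- exact: DD. - exact: SS. - exact: DD.
- exact: DD. - exact: SS. - exact: SS.
- exact: ZZ. - exact: ZZ. - exact: ZZ.
Qed.

Lemma symm_alg_1_neq0 : (1 : symm_alg) != 0.
Proof.
apply/negP => /eqP e10.
have /idealP[s sE] : 1 \in ideal (symm_rels K).
  by rewrite -[1]subr0 -qproj_eq raddf0; apply/eqP.
have /eqP := congr1 coef1 sE.
have -> : coef1 1 = 1 by rewrite /coef1 mcoeff1 eqxx.
rewrite [coef1 _]raddf_sum big1 ?oner_eq0 // => t _.
rewrite -[LHS]/(coef1 _) !coef1M.
by rewrite (symm_rels_coef1 (mem_nth 0 (ltn_ord t.1.2))) mulr0 mul0r.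
Qed.

HB.instance Definition _ :=
  GRing.PzSemiRing_isNonZero.Build symm_alg symm_alg_1_neq0.
HB.instance Definition _ :=
  GRing.Lmodule_isLalgebra.Build k symm_alg (@qscaleAl _ _ (symm_rels K)).

Definition sproj : freealg k -> symm_alg := qproj (symm_rels K).
HB.instance Definition _ := GRing.LRMorphism.on sproj.

Definition gen (i : 'I_3) : symm_alg := sproj (fgen k i).

Definition in_degree (n : nat) (u : symm_alg) : Prop :=
  exists2 p : freealg k,
    (forall m : {fmonom 'I_3}, p@_m != 0 -> fdeg m = n) & u = sproj p.

Definition sum_sq (v : 'cV[k]_3) : symm_alg :=
  \sum_(i < 3) v i 0 *: gen i ^+ 2.

End SymmetricAlgebra.

Definition graded_iso (k : closedFieldType) (K K' : symm_kind k)
    (psi : {lrmorphism symm_alg K -> symm_alg K'}) : Prop :=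
  bijective psi /\ (forall n u, in_degree n u <-> in_degree n (psi u)).

Definition pair_iso (k : closedFieldType) (K K' : symm_kind k)
    (f : symm_alg K) (f' : symm_alg K') : Prop :=
  exists2 psi : {lrmorphism symm_alg K -> symm_alg K'},
    graded_iso psi & psi f = f'.

(* The rows of M are the coordinates of phi x, phi y, phi z: M sends the      *)
(* column of generators to the column of their images.  The choice of rows    *)
(* over columns matters: for some xi, the matrices of the graded              *)
(* automorphisms of E_xi are not closed under transposition.                  *)
Definition gr_matrix (k : closedFieldType) (K : symm_kind k)
    (phi : {lrmorphism symm_alg K -> symm_alg K}) (M : 'M[k]_3) : Prop :=
  forall i, phi (gen K i) = \sum_(j < 3) M i j *: gen K j.

(* Main.v *)
Require Import Defs.
From HB Require Import structures.
From mathcomp Require Import all_boot all_order all_fingroup all_algebra.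
From mathcomp Require Import boolp finmap monalg ring.
Set Implicit Arguments.
Unset Strict Implicit.
Unset Printing Implicit Defensive.
Import GRing.Theory.
Local Open Scope ring_scope.

(** All four families have the relations
      x_(i+1) x_(i+2) + x_(i+2) x_(i+1) + e_i x_i^2 = 0    (i mod 3)
    for suitable e : 'I_3 -> k ([symm_coef]); these are the partial derivatives
    of the cubic sum_i e_i x_i^3 / 3 + 2 x_0 x_1 x_2.  Two facts hold for a
    graded automorphism with matrix M.

    - M multiplies the cubic by a scalar ([cub_aut]), and conversely every
      invertible M with this property comes from an automorphism.  That the
      span of the partial derivatives is preserved yields a tensor which is
      symmetric and determined by its value on (0, 1, 2), provided
      e_0 e_1 e_2 <> 1 ([rel_pres_cub_map]).
    - On the span of the squares the automorphism acts through the matrix of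
      the squares of the linear forms given by M, reduced modulo the relations:
      it sends sum_i v_i x_i^2 to the element with coordinates
      (sq_mx e M)^T v ([morphism_sum_sqs]).

    Hence the theorem compares the orbits of the matrices M with the orbits of
    the matrices (sq_mx e M)^T, and it suffices that M |-> (sq_mx e M)^T maps
    the group of all M onto itself ([sq_mx_aut]).

    This follows from the covariance of the Hessian determinant
    ([cub_map_hess]).  The Hessian of a combination of sum_i e_i x_i^3 and
    x_0 x_1 x_2 is again such a combination, so M carries x_0 x_1 x_2, and with
    it the sum of the e_i x_i^3, to a combination of the two, provided
    e_0 e_1 e_2 <> -8.
    When all e_i are equal to some xi <> 0, the trilinear form of
    sum_i x_i^3 then shows that (sq_mx e M)^T M is a scalar matrix, so that
    (sq_mx e M)^T is a multiple of M^-1; taking a square root of the scalar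
    gives surjectivity ([sq_mx_aut_scalar]).
    When e_0 e_1 e_2 = 0, a second application of the Hessian shows that M
    preserves x_0 x_1 x_2 up to a scalar.  Then M is monomial
    ([cub_aut_monomial]), (sq_mx e M)^T consists of the squares of the entries
    of the transpose of M, and surjectivity amounts to a compatible choice of
    square roots ([sq_mx_aut_monomial]).

    On the algebra side, the coefficients of degree at most 2 in the free
    algebra show that the generators, and their squares, are linearly
    independent modulo the relations. *)

(** * Indices modulo 3 *)

Lemma I3_ind (P : 'I_3 -> Prop) : P 0 -> P 1 -> P 2%:R -> forall i, P i.
Proof.
move=> P0 P1 P2 [[|[|[|//]]] lt_i3].
- by have -> : Ordinal lt_i3 = 0 by apply: val_inj.
- by have -> : Ordinal lt_i3 = 1 by apply: val_inj.
- by have -> : Ordinal lt_i3 = 2%:R by apply: val_inj.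
Qed.

Lemma sum_I3 (V : nmodType) (F : 'I_3 -> V) :
  \sum_i F i = F 0 + F 1 + F 2%:R.
Proof.
rewrite !big_ord_recr big_ord0 /= add0r.
by congr (F _ + F _ + F _); apply: val_inj.
Qed.

Lemma prod_I3 (R : pzSemiRingType) (F : 'I_3 -> R) :
  \prod_i F i = F 0 * F 1 * F 2%:R.
Proof.
rewrite !big_ord_recr big_ord0 /= mul1r.
by congr (F _ * F _ * F _); apply: val_inj.
Qed.

Lemma I3E : (((0 + 1 = 1 :> 'I_3)%R * (1 + 1 = 2%:R :> 'I_3)%R) *
  ((2%:R + 1 = 0 :> 'I_3)%R * (0 + 2%:R = 2%:R :> 'I_3)%R) *
  ((1 + 2%:R = 0 :> 'I_3)%R * (2%:R + 2%:R = 1 :> 'I_3)%R))%type.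
Proof. by do !split; apply: val_inj. Qed.

Lemma I3_addK (m : 'I_3) :
  (((m + 1 + 1 = m + 2%:R)%R * (m + 1 + 2%:R = m)%R) *
   ((m + 2%:R + 1 = m)%R * (m + 2%:R + 2%:R = m + 1)%R))%type.
Proof. by elim/I3_ind: m; do !split; apply: val_inj. Qed.

Lemma I3_cases (i j : 'I_3) : [\/ j = i, j = i + 1 | j = i + 2%:R].
Proof.
by elim/I3_ind: i; elim/I3_ind: j; rewrite !I3E;
  (exact: Or31 || exact: Or32 || exact: Or33).
Qed.

(** * A pencil of plane cubics and its Hessian *)

Section Cubics.
Variable k : comNzRingType.
Implicit Types (e f : 'I_3 -> k) (c d : k) (u v w : 'cV[k]_3) (M : 'M[k]_3).

(** The i-th relation as a symmetric bilinear form: the polarization of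
    e_i v_i^2 + 2 v_(i+1) v_(i+2). *)
Definition cub_partial e (i : 'I_3) v w : k :=
  e i * v i 0 * w i 0 + v (i + 1) 0 * w (i + 2%:R) 0
  + v (i + 2%:R) 0 * w (i + 1) 0.

(** The symmetric trilinear form which restricts on the diagonal to
    sum_i e_i u_i^3 + 6 c u_0 u_1 u_2. *)
Definition cub e c u v w : k :=
  \sum_i u i 0 * (e i * v i 0 * w i 0
    + c * (v (i + 1) 0 * w (i + 2%:R) 0 + v (i + 2%:R) 0 * w (i + 1) 0)).

(** Substituting M carries the cubic with coefficients (e, c) to the one with
    coefficients (f, d). *)
Definition cub_map M e c f d :=
  forall u v w, cub e c (M *m u) (M *m v) (M *m w) = cub f d u v w.

Lemma cub_partialE e u v w : cub e 1 u v w = \sum_i u i 0 * cub_partial e i v w.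
Proof. by apply: eq_bigr => i _; rewrite mul1r /cub_partial addrA. Qed.

(** The Hessian matrix at u, up to a constant factor. *)
Definition hess e c u : 'M[k]_3 :=
  \matrix_(i, j) cub e c u (delta_mx i 0) (delta_mx j 0).

Lemma det2 (A : 'M[k]_2) : \det A = A 0 0 * A 1 1 - A 0 1 * A 1 0.
Proof.
rewrite (expand_det_row _ 0) !big_ord_recr big_ord0 /= add0r /cofactor.
rewrite !det_mx11 !mxE /= expr0 mul1r expr1 mulN1r mulrN.
by congr (A _ _ * A _ _ - A _ _ * A _ _); apply: val_inj.
Qed.

Lemma det3 M : \det M =
  M 0 0 * (M 1 1 * M 2%:R 2%:R - M 2%:R 1 * M 1 2%:R)
 - M 0 1 * (M 1 0 * M 2%:R 2%:R - M 2%:R 0 * M 1 2%:R)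
 + M 0 2%:R * (M 1 0 * M 2%:R 1 - M 2%:R 0 * M 1 1).
Proof.
rewrite (expand_det_row _ 0) sum_I3 /cofactor !det2 !mxE /=.
have l00 : lift 0 0 = 1 :> 'I_3 by apply: val_inj.
have l01 : lift 0 1 = 2%:R :> 'I_3 by apply: val_inj.
have l10 : lift 1 0 = 0 :> 'I_3 by apply: val_inj.
have l11 : lift 1 1 = 2%:R :> 'I_3 by apply: val_inj.
have l20 : lift 2%:R 0 = 0 :> 'I_3 by apply: val_inj.
have l21 : lift 2%:R 1 = 1 :> 'I_3 by apply: val_inj.
rewrite l00 l01 l10 l11 l20 l21 /=; ring.
Qed.

(** The Hessian determinant of a member of the pencil is again a member.  The
    factor 6 avoids a division. *)
Lemma det_hess e c u : 6%:R * \det (hess e c u) =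
  cub (fun i => - 6%:R * c ^+ 2 * e i)
      (e 0 * e 1 * e 2%:R + 2%:R * c ^+ 3) u u u.
Proof.
by rewrite det3 /hess !mxE /cub !sum_I3 !I3E !mxE /=; ring.
Qed.

Lemma cub_polarize e c u v w :
  6%:R * cub e c u v w =
  let g u := cub e c u u u in
  g (u + v + w) - g (u + v) - g (v + w) - g (u + w) + g u + g v + g w.
Proof.
by rewrite /cub !sum_I3 !I3E !mxE; ring.
Qed.

Lemma hess_map M e c f d : cub_map M e c f d ->
  forall u, M^T *m hess e c (M *m u) *m M = hess f d u.
Proof.
move=> H u.
apply/matrixP=> i j; rewrite !mxE -H -!colE.
rewrite !sum_I3 !mxE !sum_I3 !mxE /cub !sum_I3 !I3E !mxE !sum_I3 /=.
ring.
Qed.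

Lemma cub_map_diag M e c f d :
  (forall u, cub e c (M *m u) (M *m u) (M *m u) = cub f d u u u) ->
  GRing.lreg (6%:R : k) -> cub_map M e c f d.
Proof.
move=> H reg6 u v w; apply: reg6.
by rewrite !cub_polarize /= -!mulmxDr !H.
Qed.

(** Covariance of the Hessian determinant. *)
Lemma cub_map_hess M e c f d : cub_map M e c f d -> GRing.lreg (6%:R : k) ->
  cub_map M
    (fun i => \det M ^+ 2 * (- 6%:R * c ^+ 2 * e i))
    (\det M ^+ 2 * (e 0 * e 1 * e 2%:R + 2%:R * c ^+ 3))
    (fun i => - 6%:R * d ^+ 2 * f i) (f 0 * f 1 * f 2%:R + 2%:R * d ^+ 3).
Proof.
move=> /hess_map H reg6; apply: cub_map_diag => // u.
rewrite -det_hess -H !det_mulmx det_tr.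
transitivity (\det M ^+ 2 * (6%:R * \det (hess e c (M *m u)))); last by ring.
rewrite det_hess /cub !sum_I3 !I3E.
ring.
Qed.

Lemma cub_map_lin M a e c f d a' e' c' f' d' :
  cub_map M e c f d -> cub_map M e' c' f' d' ->
  cub_map M (fun i => a * e i + a' * e' i) (a * c + a' * c')
    (fun i => a * f i + a' * f' i) (a * d + a' * d').
Proof.
have linE e1 c1 e2 c2 u v w :
    cub (fun i => a * e1 i + a' * e2 i) (a * c1 + a' * c2) u v w =
    a * cub e1 c1 u v w + a' * cub e2 c2 u v w.
  by rewrite /cub !sum_I3; ring.
by move=> H H' u v w; rewrite !linE H H'.
Qed.

(** The value of [cub e c] on the standard basis vectors i, j, l. *)
Definition cub_coef e c (i j l : 'I_3) : k :=
  if (i == j) && (j == l) then e i else if uniq [:: i; j; l] then c else 0.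

Lemma cub_delta e c i j l :
  cub e c (delta_mx i 0) (delta_mx j 0) (delta_mx l 0) = cub_coef e c i j l.
Proof.
by elim/I3_ind: i; elim/I3_ind: j; elim/I3_ind: l;
  rewrite /cub /cub_coef !sum_I3 !I3E !mxE /=; ring.
Qed.

Lemma cub_map_inj M e c f d f' d' :
  cub_map M e c f d -> cub_map M e c f' d' -> f =1 f' /\ d = d'.
Proof.
move=> H H'.
have E i j l : cub_coef f d i j l = cub_coef f' d' i j l.
  by rewrite -!cub_delta -H H'.
split=> [i|]; last exact: (E 0 1 2%:R).
by have := E i i i; rewrite /cub_coef !eqxx.
Qed.

Lemma cub_map_ext M e c f d e' c' f' d' :
  e =1 e' -> c = c' -> f =1 f' -> d = d' ->
  cub_map M e c f d -> cub_map M e' c' f' d'.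
Proof.
move=> Ee -> Ef -> H u v w.
transitivity (cub e c' (M *m u) (M *m v) (M *m w)).
  by rewrite /cub !sum_I3 !Ee.
by rewrite H /cub !sum_I3 !Ef.
Qed.

(** Substituting M carries each relation to a combination of the relations:
    the quadratic form with symmetric matrix A lies in their span if and only
    if A_(m,m) = e_m A_(m+1,m+2) for all m. *)
Definition rel_pres e M := forall i m,
  cub_partial e i (M *m delta_mx m 0) (M *m delta_mx m 0) =
  e m * cub_partial e i (M *m delta_mx (m + 1) 0) (M *m delta_mx (m + 2%:R) 0).

Lemma cub_basis M e c u v w : cub e c (M *m u) (M *m v) (M *m w) =
  \sum_a \sum_b \sum_l u a 0 * v b 0 * w l 0 *
    cub e c (col a M) (col b M) (col l M).
Proof.
by rewrite !sum_I3 /cub !sum_I3 !I3E !mxE !sum_I3; ring.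
Qed.

End Cubics.

(** * The group of matrices preserving the cubic up to a scalar *)

Section Aut.
Variable k : fieldType.
Implicit Types (e f : 'I_3 -> k) (c d : k) (u v w : 'cV[k]_3) (M : 'M[k]_3).

(** The invertible matrices which multiply sum_i e_i u_i^3 + 6 u_0 u_1 u_2 by
    a scalar. *)
Definition cub_aut e M :=
  M \in unitmx /\ exists l, cub_map M e 1 (fun i => l * e i) l.

Lemma cubC12 e c u v w : cub e c u v w = cub e c v u w.
Proof. by rewrite /cub !sum_I3 !I3E; ring. Qed.

Lemma cubC23 e c u v w : cub e c u v w = cub e c u w v.
Proof. by rewrite /cub !sum_I3 !I3E; ring. Qed.

Lemma cub_basis1 e c u v w : cub e c u v w =
  \sum_a \sum_b \sum_l u a 0 * v b 0 * w l 0 *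
    cub e c (delta_mx a 0) (delta_mx b 0) (delta_mx l 0).
Proof.
rewrite -{1}[u]mul1mx -{1}[v]mul1mx -{1}[w]mul1mx cub_basis.
apply: eq_bigr => a _; apply: eq_bigr => b _; apply: eq_bigr => l _.
by rewrite !colE !mul1mx.
Qed.

Lemma cub_map_basis M e c f d :
  (forall i j l,
    cub e c (M *m delta_mx i 0) (M *m delta_mx j 0) (M *m delta_mx l 0) =
    cub f d (delta_mx i 0) (delta_mx j 0) (delta_mx l 0)) ->
  cub_map M e c f d.
Proof.
move=> H u v w; rewrite cub_basis cub_basis1.
apply: eq_bigr => a _; apply: eq_bigr => b _; apply: eq_bigr => l _.
by rewrite !colE H.
Qed.

(** Let T be the transformed trilinear form on the basis vectors.  By
    hypothesis T j m m = e_m T j (m+1) (m+2); using this three times together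
    with the symmetry of T gives T j m m = e_0 e_1 e_2 T j m m for j <> m. *)
Lemma rel_pres_cub_map e M : e 0 * e 1 * e 2%:R != 1 ->
  rel_pres e M -> exists l, cub_map M e 1 (fun i => l * e i) l.
Proof.
move=> e_neq1 H.
pose E i : 'cV[k]_3 := M *m delta_mx i 0.
pose T i j l := cub e 1 (E i) (E j) (E l).
have Trel j m : T j m m = e m * T j (m + 1) (m + 2%:R).
  rewrite /T !cub_partialE mulr_sumr; apply: eq_bigr => i _.
  by rewrite H mulrCA.
have T12 i j l : T i j l = T j i l by exact: cubC12.
have T23 i j l : T i j l = T i l j by exact: cubC23.
have eps m : e m * e (m + 1) * e (m + 2%:R) != 1.
  elim/I3_ind: m; rewrite !I3E //; first by rewrite mulrC mulrA.
  by rewrite -mulrA mulrC.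
have fix0 m x : x = e m * e (m + 1) * e (m + 2%:R) * x -> x = 0.
  move=> /eqP; rewrite -{1}[x]mul1r -subr_eq0 -mulrBl mulf_eq0 subr_eq0.
  by rewrite eq_sym (negPf (eps m)) => /eqP.
have rot i j l : T i j l = T l i j by rewrite T23 T12.
have T1 m : T (m + 1) m m = 0.
  apply: (fix0 m).
  have step n : T (n + 1) n n = e n * T (n + 1 + 1) (n + 1) (n + 1).
    by rewrite Trel rot I3_addK.
  by rewrite {1}step step step !I3_addK !mulrA.
have T2 m : T (m + 2%:R) m m = 0.
  apply: (fix0 m).
  have step n :
      T (n + 2%:R) n n = e n * T (n + 2%:R + 2%:R) (n + 2%:R) (n + 2%:R).
    by rewrite Trel T12 I3_addK.
  rewrite {1}step step step !I3_addK !mulrA; congr (_ * _).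
  by rewrite mulrAC.
have T0 m : T m (m + 1) (m + 2%:R) = T 0 1 2%:R.
  by elim/I3_ind: m; rewrite !I3E; [|rewrite rot|rewrite rot rot].
have T1' m : T m (m + 2%:R) (m + 2%:R) = 0.
  by have := T1 (m + 2%:R); rewrite I3_addK.
have T2' m : T m (m + 1) (m + 1) = 0 by have := T2 (m + 1); rewrite I3_addK.
have T3 m : T m m m = e m * T 0 1 2%:R by rewrite Trel T0.
exists (T 0 1 2%:R); apply: cub_map_basis => i j l.
rewrite cub_delta -/(T i j l); move: (T 0 1 2%:R) T0 T3 => x T0 T3.
(* The nine cases are normalized by the position of j and l relative to i. *)
have -> : T i j l = x * cub_coef e 1 i j l.
  have [->|->|->] := I3_cases i j; have [->|->|->] := I3_cases i l;
    rewrite ?T3 ?T1' ?T2' ?(T12 i _ i) ?(rot i i) ?T1 ?T2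
      ?(T23 i (i + 2%:R) (i + 1)) ?T0;
    by elim/I3_ind: i; rewrite ?I3E /cub_coef /= ?mulr1 ?mulr0 // mulrC.
by rewrite /cub_coef; case: ifP => // _; case: ifP; rewrite ?mulr1 ?mulr0.
Qed.

(** Conversely, evaluate at the preimage of the i-th basis vector. *)
Lemma cub_map_rel_pres e M l : M \in unitmx ->
  cub_map M e 1 (fun i => l * e i) l -> rel_pres e M.
Proof.
move=> uM H i m.
pose u := invmx M *m delta_mx i 0.
have pol v w : cub_partial e i v w = cub e 1 (delta_mx i 0) v w.
  rewrite cub_partialE (bigD1 i) //= mxE !eqxx mul1r big1 ?addr0 // => j ne_ji.
  by rewrite mxE (negPf ne_ji) mul0r.
rewrite !pol -(mulKVmx uM (delta_mx i 0)) -/u !H /cub mulr_sumr.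
by elim/I3_ind: m; rewrite !sum_I3 !I3E !mxE /=; ring.
Qed.

Lemma cub_aut_scalar_neq0 e M l : M \in unitmx ->
  cub_map M e 1 (fun i => l * e i) l -> l != 0.
Proof.
move=> uM H; apply/eqP=> l0.
have := cub_delta e 1 0 1 2%:R.
rewrite -(mulKVmx uM (delta_mx 0 0)) -(mulKVmx uM (delta_mx 1 0)).
rewrite -(mulKVmx uM (delta_mx 2%:R 0)) H l0 /cub !sum_I3 => /eqP.
by rewrite !(mul0r, mulr0, addr0) eq_sym oner_eq0.
Qed.

Lemma cub_aut_inv e M : cub_aut e M -> cub_aut e (invmx M).
Proof.
move=> [uM [l H]]; split; first by rewrite unitmx_inv.
have l0 := cub_aut_scalar_neq0 uM H.
exists l^-1 => u v w.
have cubZ a x y z : cub (fun i => a * e i) a x y z = a * cub e 1 x y z.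
  by rewrite /cub !sum_I3; ring.
rewrite cubZ -{2}(mulKVmx uM u) -{2}(mulKVmx uM v) -{2}(mulKVmx uM w) H cubZ.
by rewrite mulKf.
Qed.

Lemma cub_aut_scale e M a : a != 0 -> cub_aut e M -> cub_aut e (a *: M).
Proof.
move=> a0 [uM [l H]]; split; first by rewrite unitmxZ ?unitfE.
exists (a ^+ 3 * l) => u v w; rewrite -!scalemxAl.
transitivity (a ^+ 3 * cub e 1 (M *m u) (M *m v) (M *m w)).
  by rewrite /cub !sum_I3 !I3E !mxE; ring.
by rewrite H /cub !sum_I3; ring.
Qed.

End Aut.

(** * Matrices of squares of linear forms *)

Section Char0.
Variable k : closedFieldType.
Hypothesis char0 : [pchar k] =i pred0.
Implicit Types (e f : 'I_3 -> k) (c d : k) (u v w : 'cV[k]_3) (M : 'M[k]_3).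

Lemma natr_neq0 n : (n.+1%:R : k) != 0.
Proof. by rewrite (pcharf0P k).1. Qed.

Lemma lreg6 : GRing.lreg (6%:R : k).
Proof. exact/mulfI/natr_neq0. Qed.

(** In a suitable combination of the cubic and its Hessian the cubes cancel, and
    a nonzero multiple of u_0 u_1 u_2 remains. *)
Lemma cub_aut_xyz e M : e 0 * e 1 * e 2%:R + 8%:R != 0 -> cub_aut e M ->
  exists a b, cub_map M (fun=> 0) 1 (fun i => a * e i) b.
Proof.
move=> e8 [uM [l H]].
have D0 : \det M != 0 by rewrite -unitfE -unitmxE.
pose a := (\det M ^+ 2 * (e 0 * e 1 * e 2%:R + 8%:R))^-1.
have H' := cub_map_lin a (a * (6%:R * \det M ^+ 2)) (cub_map_hess H lreg6) H.
exists (a * (6%:R * \det M ^+ 2 * l - 6%:R * l ^+ 3)),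
  (a * (l ^+ 3 * (e 0 * e 1 * e 2%:R + 2%:R) + 6%:R * \det M ^+ 2 * l)).
apply: cub_map_ext H' => [i||i|] /=; first 1 last.
- by rewrite /a; field; rewrite D0 e8.
- by ring.
- by ring.
by ring.
Qed.

(** Row i holds the coordinates of (sum_j M_ij x_j)^2 in x_0^2, x_1^2, x_2^2
    modulo the relations. *)
Definition sq_mx e M : 'M[k]_3 :=
  \matrix_(i, m) (M i m ^+ 2 - e m * M i (m + 1) * M i (m + 2%:R)).

Lemma sq_mxZ e M a : sq_mx e (a *: M) = a ^+ 2 *: sq_mx e M.
Proof. by apply/matrixP=> i m; rewrite !mxE; ring. Qed.

(** A row (a, b, c) of M with a^2 = x b c, b^2 = x c a and c^2 = x a b has
    (a b c)^2 = x^3 (a b c)^2. *)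
Lemma sq_mx_eq0 x M : x ^+ 3 != 1 -> sq_mx (fun=> x) M = 0 -> M = 0.
Proof.
move=> x3 N0; apply/matrixP=> i j; rewrite [RHS]mxE.
have sqE m : M i m ^+ 2 = x * M i (m + 1) * M i (m + 2%:R).
  move/matrixP: N0 => /(_ i m); rewrite !mxE => /eqP.
  by rewrite subr_eq0 => /eqP.
have := sqE 2%:R; have := sqE 1; have := sqE 0; rewrite !I3E => s0 s1 s2.
have /eqP : (M i 0 * M i 1 * M i 2%:R) ^+ 2 * (1 - x ^+ 3) = 0.
  suff P2 : (M i 0 * M i 1 * M i 2%:R) ^+ 2 =
            x ^+ 3 * (M i 0 * M i 1 * M i 2%:R) ^+ 2.
    by rewrite mulrBr mulr1 {1}P2; ring.
  by rewrite {1}exprMn {1}exprMn s0 s1 s2; ring.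
rewrite mulf_eq0 subr_eq0 [1 == _]eq_sym (negPf x3) orbF expf_eq0 /= !mulf_eq0.
have sq0 (y : k) : y ^+ 2 = 0 -> y = 0 by move/eqP; rewrite expf_eq0 /= => /eqP.
case/orP=> [/orP[]|] /eqP M0; elim/I3_ind: j => //; apply: sq0;
  by rewrite ?s0 ?s1 ?s2 M0 ?mulr0 ?mul0r.
Qed.

(** M carries sum_i u_i^3 to a combination of sum_i u_i^3 and u_0 u_1 u_2; the
    (m, l) entry of the product of the transpose of [sq_mx] with M is read off
    the values of this combination at (m, m, l) and (m+1, m+2, l). *)
Lemma sq_mx_inv x M : x != 0 -> x ^+ 3 != 1 -> x ^+ 3 + 8%:R != 0 ->
  cub_aut (fun=> x) M ->
  exists2 a, a != 0 & (sq_mx (fun=> x) M)^T = a *: invmx M.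
Proof.
move=> x0 x1 x8 autM; have [uM [l H]] := autM.
have [|a [b H']] := cub_aut_xyz _ autM; first by rewrite -expr2 -exprSr.
have Hg := cub_map_lin 1 (-1) H H'.
have NM : (sq_mx (fun=> x) M)^T *m M = (l - a - (l - b))%:M.
  apply/matrixP=> i j; apply: (mulfI x0).
  transitivity (
    cub (fun=> x) 0 (M *m delta_mx i 0) (M *m delta_mx i 0)
        (M *m delta_mx j 0)
    - x * cub (fun=> x) 0 (M *m delta_mx (i + 1) 0)
        (M *m delta_mx (i + 2%:R) 0) (M *m delta_mx j 0)).
    by rewrite -!colE /cub !mxE !sum_I3 !I3E !mxE; ring.
  have Hg' : cub_map M (fun=> x) 0 (fun=> (l - a) * x) (l - b).
    by apply: cub_map_ext Hg => [i'||i'|] /=; ring.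
  rewrite !Hg' /cub !sum_I3 !mxE.
  by elim/I3_ind: i; elim/I3_ind: j; rewrite !I3E /=; ring.
move: (l - a - (l - b)) NM => ch NM; exists ch.
  apply/eqP=> ch0; move: NM; rewrite ch0 raddf0 => NM.
  have /sq_mx_eq0 : sq_mx (fun=> x) M = 0.
    by apply: (can_inj trmxK); rewrite trmx0 -[LHS](mulmxK uM) NM mul0mx.
  by move=> /(_ x1) M0; move: uM; rewrite M0 unitmxE det0 unitr0.
by rewrite -[LHS](mulmxK uM) NM mul_scalar_mx.
Qed.

Lemma sqr_surj (a : k) : exists b, b ^+ 2 = a.
Proof.
have [b Hb] := @solve_monicpoly k 2 (fun i => if i == 0%N then a else 0) isT.
by exists b; rewrite Hb !big_ord_recr big_ord0 /= expr0 add0r mulr1 mul0r addr0.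
Qed.

Lemma sq_mx_aut_scalar x : x != 0 -> x ^+ 3 != 1 -> x ^+ 3 + 8%:R != 0 ->
  forall M, cub_aut (fun=> x) M <->
    exists2 M', cub_aut (fun=> x) M' & (sq_mx (fun=> x) M')^T = M.
Proof.
move=> x0 x1 x8 M; split=> [autM|[M' autM' <-]]; last first.
  have [a a0 ->] := sq_mx_inv x0 x1 x8 autM'.
  exact/cub_aut_scale/cub_aut_inv.
have [a a0 Na] := sq_mx_inv x0 x1 x8 (cub_aut_inv autM).
have [c c2] := sqr_surj a^-1.
exists (c *: invmx M).
  apply/cub_aut_scale/cub_aut_inv => //.
  by apply: contraNneq a0 => c0; rewrite -[a]invrK -c2 c0 expr0n invr0.
by rewrite sq_mxZ linearZ /= Na c2 scalerA mulVf // scale1r invmxK.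
Qed.

End Char0.

(** * The degenerate cubics: monomial matrices *)

Section Monomial.
Variable k : closedFieldType.
Hypothesis char0 : [pchar k] =i pred0.
Implicit Types (e f : 'I_3 -> k) (c d : k) (u v w : 'cV[k]_3) (M : 'M[k]_3).

(** If M carries u_0 u_1 u_2 to a combination with a nonzero cubic part a e,
    comparing the Hessians of both sides gives 3 b^2 = - det(M)^2 and
    b^3 = det(M)^2 b, where b is the other coefficient; this is impossible. *)
Lemma cub_aut_xyz_inv e M : e 0 * e 1 * e 2%:R = 0 -> cub_aut e M ->
  exists b, cub_map M (fun=> 0) 1 (fun=> 0) b.
Proof.
move=> e0 autM; have [uM _] := autM.
have [|a [b H]] := cub_aut_xyz char0 _ autM.
  by rewrite e0 add0r natr_neq0.
have D0 : \det M ^+ 2 != 0 by rewrite expf_neq0 // -unitfE -unitmxE.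
have Hh := cub_map_hess H (lreg6 char0).
move: (\det M ^+ 2) D0 Hh => D2 D0 Hh.
(* The left-hand side is the Hessian of u_0 u_1 u_2 as it appears in Hh. *)
have Hl : cub_map M (fun i => D2 * (- 6%:R * 1 ^+ 2 * 0))
    (D2 * (0 * 0 * 0 + 2%:R * 1 ^+ 3))
    (fun i => D2 * 2%:R * (a * e i)) (D2 * 2%:R * b).
  by apply: cub_map_ext (cub_map_lin (D2 * 2%:R) 0 H H) => [i||i|] /=; ring.
have [E1 E2] := cub_map_inj Hh Hl.
exists b; apply: cub_map_ext H => // i.
apply/eqP/negP => /negP ai0.
have b2 : 3%:R * b ^+ 2 = - D2.
  apply: (mulfI (mulf_neq0 (natr_neq0 char0 1) ai0)).
  apply: oppr_inj; rewrite !mulrN opprK.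
  by transitivity (D2 * 2%:R * (a * e i)); [rewrite -E1|]; ring.
have aea : (a * e 0) * (a * e 1) * (a * e 2%:R) = 0.
  by rewrite -(mulr0 (a ^+ 3)) -e0; ring.
rewrite aea add0r in E2.
have /eqP : 8%:R * (b * D2) = 0.
  transitivity (3%:R * (D2 * 2%:R * b) - 2%:R * b * (- D2)); first by ring.
  by rewrite -E2 -b2; ring.
rewrite !mulf_eq0 (negPf D0) (negPf (natr_neq0 char0 7)) orbF /= => /eqP b0.
by move/eqP: b2; rewrite b0 expr0n mulr0 eq_sym oppr_eq0 (negPf D0).
Qed.

(** Since u_0 u_1 u_2 is preserved, its trilinear form vanishes whenever two
    arguments are equal to the j-th column of M; the third one is arbitrary. *)
Lemma cub_aut_col0 e M i j : e 0 * e 1 * e 2%:R = 0 -> cub_aut e M ->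
  M (i + 1) j * M (i + 2%:R) j = 0.
Proof.
move=> e0 autM; have [b H] := cub_aut_xyz_inv e0 autM.
have uM := autM.1.
apply: (mulfI (natr_neq0 char0 1)); rewrite mulr0.
transitivity (cub (fun=> 0) 1 (M *m (invmx M *m delta_mx i 0))
                  (M *m delta_mx j 0) (M *m delta_mx j 0)).
  rewrite mulKVmx // -colE /cub (bigD1 i) //= !mxE !eqxx /= big1 => [|l ne_li].
    by ring.
  by rewrite !mxE (negPf ne_li) mul0r.
by rewrite H /cub !sum_I3 !mxE; elim/I3_ind: j; rewrite !I3E /=; ring.
Qed.

(** The matrix whose only nonzero entry in row i is t i, in column s i. *)
Definition monomial_mx (s : 'S_3) (t : 'I_3 -> k) : 'M[k]_3 :=
  \matrix_(i, j) (t i *+ (j == s i)).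

Lemma cub_aut_monomial e M : e 0 * e 1 * e 2%:R = 0 -> cub_aut e M ->
  exists s t, M = monomial_mx s t.
Proof.
move=> e0 autM.
have col0 i i' j : i != i' -> M i j != 0 -> M i' j = 0.
  move=> ne_ii nz; apply/eqP; move: nz; apply: contraR => nz'.
  suff /eqP : M i j * M i' j = 0 by rewrite mulf_eq0 (negPf nz') orbF.
  have [iE|->|->] := I3_cases i' i; first by rewrite iE eqxx in ne_ii.
    by have := cub_aut_col0 (i' + 2%:R) j e0 autM; rewrite !I3_addK mulrC => ->.
  by have := cub_aut_col0 (i' + 1) j e0 autM; rewrite !I3_addK => ->.
have /existsP[s /forallP nz] : [exists s : 'S_3, [forall i, M i (s i) != 0]].
  apply: contraT; rewrite negb_exists => /forallP no.
  case: autM; rewrite unitmxE /determinant big1 ?unitr0 // => s _.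
  have := no s; rewrite negb_forall => /existsP[i]; rewrite negbK => /eqP Mi0.
  by rewrite (bigD1 i) //= Mi0 mul0r mulr0.
exists s, (fun i => M i (s i)); apply/matrixP=> i j; rewrite mxE.
have [->//|ne_j] := eqVneq j (s i); rewrite mulr0n.
have := nz (s^-1 j)%g; rewrite permKV => /col0; apply.
by apply: contraNneq ne_j => <-; rewrite permKV.
Qed.

Lemma monomial_delta s t i :
  monomial_mx s t *m delta_mx (s i) 0 = t i *: delta_mx i 0 :> 'cV_3.
Proof.
rewrite -colE; apply/colP=> j; rewrite !mxE eqxx andbT (inj_eq perm_inj) eq_sym.
by case: eqP => [->|_]; rewrite ?mulr1 ?mulr0.
Qed.

(** The two conditions are the invariance of u_0 u_1 u_2 and of the cubes. *)
Lemma cub_map_monomial s t e l :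
  cub_map (monomial_mx s t) e 1 (fun i => l * e i) l <->
  t 0 * t 1 * t 2%:R = l /\ forall i, e i * t i ^+ 3 = l * e (s i).
Proof.
have cubt x y z i j r : cub e 1 (x *: delta_mx i 0) (y *: delta_mx j 0)
     (z *: delta_mx r 0) = x * y * z * cub_coef e 1 i j r.
  by rewrite -cub_delta /cub !sum_I3 !mxE; ring.
have coefl i j r : cub_coef (fun i => l * e i) l i j r = l * cub_coef e 1 i j r.
  rewrite /cub_coef; case: ifP => _ //.
  by case: ifP => _; rewrite ?mulr1 ?mulr0.
split=> [H|[tl tE]].
  split=> [|i].
    have := H (delta_mx (s 0) 0) (delta_mx (s 1) 0) (delta_mx (s 2%:R) 0).
    rewrite !(monomial_delta s t) cubt cub_delta coefl /cub_coef /= !inE.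
    rewrite !(inj_eq (@perm_inj _ s)) /=.
    by rewrite !mulr1.
  have := H (delta_mx (s i) 0) (delta_mx (s i) 0) (delta_mx (s i) 0).
  rewrite !(monomial_delta s t) cubt cub_delta coefl /cub_coef !eqxx /= => <-.
  by ring.
apply: cub_map_basis => i j r.
rewrite -(permKV s i) -(permKV s j) -(permKV s r).
move: (s^-1 i)%g (s^-1 j)%g (s^-1 r)%g => {}i {}j {}r.
rewrite !(monomial_delta s t) cubt cub_delta coefl /cub_coef /= !inE.
rewrite !(inj_eq (@perm_inj _ s)).
case: ifP => [/andP[/eqP<- /eqP<-]|_]; first by rewrite -tE; ring.
case: ifP => [|_]; last by rewrite !mulr0.
rewrite !mulr1 -tl.
by elim/I3_ind: i; elim/I3_ind: j; elim/I3_ind: r => //=; move=> *; ring.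
Qed.

Lemma unit_monomial s t :
  (monomial_mx s t \in unitmx) = (t 0 * t 1 * t 2%:R != 0).
Proof.
have -> : monomial_mx s t = diag_mx (\row_i t i) *m perm_mx s.
  apply/matrixP=> i j; rewrite mul_diag_mx !mxE eq_sym.
  by case: eqP => _; rewrite ?mulr1 ?mulr0.
rewrite unitmxE det_mulmx det_diag det_perm unitfE mulf_eq0 signr_eq0 orbF.
by rewrite prod_I3 !mxE.
Qed.

Lemma cub_aut_monomialE e s t : cub_aut e (monomial_mx s t) <->
  t 0 * t 1 * t 2%:R != 0 /\
  forall i, e i * t i ^+ 3 = t 0 * t 1 * t 2%:R * e (s i).
Proof.
rewrite /cub_aut unit_monomial.
split=> [[uM [l /cub_map_monomial[<- H]]]|[uM H]] //.
by split=> //; exists (t 0 * t 1 * t 2%:R); apply/cub_map_monomial.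
Qed.

Lemma sq_mx_monomial e s t :
  (sq_mx e (monomial_mx s t))^T = monomial_mx s^-1 (fun i => t (s^-1 i)%g ^+ 2).
Proof.
apply/matrixP=> j i; rewrite !mxE -(can2_eq (permKV s) (permK s)).
have neS : j + 1 != j + 2%:R by elim/I3_ind: j.
have -> : e j * (t i *+ (j + 1 == s i)) * (t i *+ (j + 2%:R == s i)) = 0.
  case: (eqVneq (j + 1) (s i)) => [<-|_]; last by rewrite mulr0n mulr0 mul0r.
  by rewrite eq_sym (negPf neS) mulr0.
rewrite subr0 eq_sym [i == _]eq_sym.
case: (eqVneq (s i) j) => [<-|ne].
  by rewrite permK eqxx !mulr1n.
rewrite [(s^-1)%g j == i](_ : _ = false) ?expr0n //.
by apply: contraNF ne => /eqP <-; rewrite permKV.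
Qed.

(** The remaining hypothesis says that the diagonal matrices t preserving the
    cubic up to a scalar have square roots with the same property. *)
Lemma sq_mx_aut_monomial e :
  e 0 * e 1 * e 2%:R = 0 -> (forall i, e i = 0 \/ e i = 1) ->
  (forall t, t 0 * t 1 * t 2%:R != 0 ->
    (forall i, e i * t i ^+ 3 = t 0 * t 1 * t 2%:R * e i) ->
    exists r, (forall i, r i ^+ 2 = t i) /\
      forall i, e i * r i ^+ 3 = r 0 * r 1 * r 2%:R * e i) ->
  forall M, cub_aut e M <->
    exists2 M', cub_aut e M' & (sq_mx e M')^T = M.
Proof.
move=> e0 e01 root M.
(* The permutation preserves the support of e, so it can be dropped. *)
have key s t : cub_aut e (monomial_mx s t) -> (forall i, e (s i) = e i) /\
    forall i, e i * t i ^+ 3 = t 0 * t 1 * t 2%:R * e i.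
  move=> /cub_aut_monomialE[t0 H].
  have es i : e (s i) = e i.
    have := H i; have [-> | ->] := e01 i.
      by rewrite mul0r => /esym/eqP; rewrite mulf_eq0 (negPf t0) => /eqP.
    rewrite mul1r => Hi; have [es0|-> //] := e01 (s i).
    move: Hi; rewrite es0 mulr0 => /eqP; rewrite expf_eq0 /= => /eqP ti.
    have /negP[] := t0; rewrite !mulf_eq0; move: ti.
    by elim/I3_ind: (i) => ->; rewrite eqxx ?orbT.
  by split=> // i; rewrite H es.
have prodS (s : 'S_3) (t : 'I_3 -> k) :
    t (s 0) * t (s 1) * t (s 2%:R) = t 0 * t 1 * t 2%:R.
  by rewrite -(prod_I3 t) (reindex_inj (@perm_inj _ s)) prod_I3.
split=> [autM|[M' autM' <-]]; last first.
  have [s [t EM]] := cub_aut_monomial e0 autM'; rewrite EM in autM' *.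
  have [es H] := key _ _ autM'; have /cub_aut_monomialE[t0 _] := autM'.
  rewrite sq_mx_monomial; apply/cub_aut_monomialE.
  rewrite -!exprMn prodS; split=> [|i]; first by rewrite expf_neq0.
  have es' : e (s^-1 i)%g = e i by rewrite -(es (s^-1 i)%g) permKV.
  have := H (s^-1 i)%g; rewrite es'.
  have [->|->] := e01 i; first by rewrite !mul0r !mulr0.
  by rewrite !(mul1r, mulr1) exprAC => ->.
have [s [t EM]] := cub_aut_monomial e0 autM; rewrite EM in autM *.
have [es H] := key _ _ autM; have /cub_aut_monomialE[t0 _] := autM.
have [r [r2 rE]] := root _ t0 H.
have es' i : e (s^-1 i)%g = e i by rewrite -(es (s^-1 i)%g) permKV.
exists (monomial_mx s^-1 (fun i => r (s^-1 i)%g)).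
  apply/cub_aut_monomialE; rewrite prodS; split=> [|i].
    by apply: contraNneq t0 => r0; rewrite -!r2 -!exprMn r0 expr0n.
  by rewrite -(es' i) rE es'.
by rewrite sq_mx_monomial invgK; apply/matrixP=> i j; rewrite !mxE permK r2.
Qed.

Lemma sqr_surj_family (t : 'I_3 -> k) :
  exists r : 'I_3 -> k, forall i, r i ^+ 2 = t i.
Proof.
by have [r rE] := choice (fun i => sqr_surj (t i)); exists r.
Qed.

Definition vec3 (a b c : k) : 'I_3 -> k :=
  fun i => if i == 0 then a else if i == 1 then b else c.

Lemma sq_mx_aut_S M : cub_aut (vec3 0 0 0) M <->
    exists2 M', cub_aut (vec3 0 0 0) M' & (sq_mx (vec3 0 0 0) M')^T = M.
Proof.
have e0 i : vec3 0 0 0 i = 0 by rewrite /vec3; case: ifP => // _; case: ifP.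
apply: sq_mx_aut_monomial => [|i|t _ _]; first by rewrite !e0 !mulr0.
  by left; rewrite e0.
have [r Hr] := sqr_surj_family t.
by exists r; split=> // i; rewrite e0 mul0r mulr0.
Qed.

(** The condition is t_0^2 = t_1 t_2; the roots of t_0 and t_1 are arbitrary and
    that of t_2 is determined by them. *)
Lemma sq_mx_aut_S' M : cub_aut (vec3 1 0 0) M <->
    exists2 M', cub_aut (vec3 1 0 0) M' & (sq_mx (vec3 1 0 0) M')^T = M.
Proof.
apply: sq_mx_aut_monomial => [|i|t].
- by rewrite /vec3 /= !mulr0.
- by elim/I3_ind: i; [right|left|left].
move=> t0 /(_ 0); rewrite /vec3 /= mul1r mulr1 => Ht.
have [r Hr] := sqr_surj_family t.
move: t0; rewrite !mulf_eq0 !negb_or => /andP[/andP[t0 t1] t2].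
have r1 : r 1 != 0 by apply: contraNneq t1 => r1; rewrite -(Hr 1) r1 expr0n.
have Ht2 : t 0 ^+ 2 = t 2%:R * t 1.
  by apply: (mulfI t0); rewrite -exprS Ht; ring.
exists (vec3 (r 0) (r 1) (r 0 ^+ 2 / r 1)); rewrite /vec3; split.
  elim/I3_ind=> /=; rewrite ?Hr // expr_div_n !Hr Ht2.
  by rewrite mulfK.
elim/I3_ind=> /=; rewrite ?mul0r ?mulr0 //.
by field.
Qed.

(** All t_i have the same cube l = t_0 t_1 t_2, so that t_i^4 = l t_i and the
    t_i^2 divided by a square root of l are square roots of the t_i. *)
Lemma sq_mx_aut_N M : cub_aut (vec3 1 1 0) M <->
    exists2 M', cub_aut (vec3 1 1 0) M' & (sq_mx (vec3 1 1 0) M')^T = M.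
Proof.
apply: sq_mx_aut_monomial => [|i|t].
- by rewrite /vec3 /= !mulr0.
- by elim/I3_ind: i; [right|right|left].
set l := t 0 * t 1 * t 2%:R => l0 Ht.
have t0 := Ht 0; have t1 := Ht 1; rewrite /vec3 /= !mul1r !mulr1 in t0 t1.
have t2 : t 2%:R ^+ 3 = l.
  by apply: (mulfI (mulf_neq0 l0 l0)); rewrite -{1}t0 -{1}t1 /l; ring.
have tl i : t i ^+ 3 = l by elim/I3_ind: i.
have [c Hc] := sqr_surj l^-1.
exists (fun i => c * t i ^+ 2); split=> i.
  by rewrite exprMn Hc -exprM (exprSr _ 3) tl mulKf.
rewrite [RHS]mulrC; congr (_ * _); rewrite exprMn exprAC tl.
by transitivity (c ^+ 3 * l ^+ 2); rewrite // /l; ring.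
Qed.

End Monomial.

(** * Quadratic elements of an algebra with the symmetric relations *)

Section Quad.
Variables (k : closedFieldType) (S : lalgType k) (x : 'I_3 -> S).
(* Scalars are central. *)
Hypothesis Ar : forall (c : k) (p q : S), p * (c *: q) = c *: (p * q).
Implicit Types (B M : 'M[k]_3) (y : 'I_3 -> S) (e : 'I_3 -> k) (v : 'cV[k]_3).

Definition lin_comb M i : S := \sum_j M i j *: x j.
Definition quad_form y B : S := \sum_i \sum_j B i j *: (y i * y j).
(** The i-th relation evaluated at y. *)
Definition symm_rel y e i : S :=
  y (i + 1) * y (i + 2%:R) + y (i + 2%:R) * y (i + 1) + e i *: y i ^+ 2.
Definition sum_sqs y v : S := \sum_i v i 0 *: y i ^+ 2.

Lemma lin_comb1 i : lin_comb 1%:M i = x i.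
Proof.
rewrite /lin_comb (bigD1 i) //= mxE eqxx scale1r big1 ?addr0 // => j ne_ji.
by rewrite mxE eq_sym (negPf ne_ji) scale0r.
Qed.

Lemma lin_comb_mulmx M M' i :
  lin_comb (M *m M') i = \sum_j M i j *: lin_comb M' j.
Proof.
transitivity (\sum_j \sum_l (M i l * M' l j) *: x j).
  by apply: eq_bigr => j _; rewrite mxE scaler_suml.
rewrite exchange_big; apply: eq_bigr => l _; rewrite scaler_sumr.
by apply: eq_bigr => j _; rewrite scalerA.
Qed.

Lemma sum_sqsB y v w : sum_sqs y (v - w) = sum_sqs y v - sum_sqs y w.
Proof.
by rewrite -sumrB; apply: eq_bigr => i _; rewrite -scalerBl !mxE.
Qed.

Lemma quad_formD y B B' : quad_form y (B + B') = quad_form y B + quad_form y B'.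
Proof.
rewrite -big_split; apply: eq_bigr => i _; rewrite -big_split.
by apply: eq_bigr => j _; rewrite mxE scalerDl.
Qed.

Lemma quad_formZ y c B : quad_form y (c *: B) = c *: quad_form y B.
Proof.
rewrite scaler_sumr; apply: eq_bigr => i _; rewrite scaler_sumr.
by apply: eq_bigr => j _; rewrite mxE scalerA.
Qed.

Lemma quad_form_sum y (I : Type) (r : seq I) (B : I -> 'M[k]_3) :
  quad_form y (\sum_(i <- r) B i) = \sum_(i <- r) quad_form y (B i).
Proof.
elim/big_rec2: _ => [|i B1 B2 _ <-]; last by rewrite quad_formD.
by rewrite -[0 in LHS](scale0r 0) quad_formZ scale0r.
Qed.

Lemma quad_form_delta y a b : quad_form y (delta_mx a b) = y a * y b.
Proof.
rewrite /quad_form (bigD1 a) //= (bigD1 b) //= mxE !eqxx scale1r.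
rewrite !big1 ?addr0 //.
  by move=> i ne; apply: big1 => j _; rewrite mxE (negPf ne) scale0r.
by move=> j ne; rewrite mxE (negPf ne) andbF scale0r.
Qed.

(** The symmetric matrix of the i-th relation. *)
Definition rel_mx e i : 'M[k]_3 :=
  delta_mx (i + 1) (i + 2%:R) + delta_mx (i + 2%:R) (i + 1)
  + e i *: delta_mx i i.

Lemma quad_form_rel y e i : quad_form y (rel_mx e i) = symm_rel y e i.
Proof. by rewrite !quad_formD quad_formZ !quad_form_delta. Qed.

Lemma quad_form_diag y v : quad_form y (diag_mx v^T) = sum_sqs y v.
Proof.
apply: eq_bigr => i _; rewrite (bigD1 i) //= !mxE eqxx mulr1n big1 ?addr0 //.
by move=> j ne; rewrite mxE eq_sym (negPf ne) mulr0n scale0r.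
Qed.

Lemma quad_form_lin_comb M B :
  quad_form (lin_comb M) B = quad_form x (M^T *m B *m M).
Proof.
have linM i j : lin_comb M i * lin_comb M j =
    quad_form x (\matrix_(a, b) (M i a * M j b)).
  rewrite /lin_comb mulr_suml; apply: eq_bigr => a _; rewrite mulr_sumr.
  by apply: eq_bigr => b _; rewrite Ar -scalerAl scalerA mxE mulrC.
transitivity (quad_form x
    (\sum_i \sum_j B i j *: \matrix_(a, b) (M i a * M j b))).
  rewrite quad_form_sum; apply: eq_bigr => i _; rewrite quad_form_sum.
  by apply: eq_bigr => j _; rewrite quad_formZ linM.
congr quad_form; apply/matrixP => a b.
rewrite summxE (eq_bigr _ (fun i _ => summxE _ _ _ _ _)) !mxE.
by rewrite !sum_I3 !mxE !sum_I3 !mxE; ring.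
Qed.

Lemma sum_sqs_lin_comb M v :
  sum_sqs (lin_comb M) v = quad_form x (M^T *m diag_mx v^T *m M).
Proof. by rewrite -quad_form_diag quad_form_lin_comb. Qed.

Lemma symm_rel_lin_comb M e i :
  symm_rel (lin_comb M) e i = quad_form x (M^T *m rel_mx e i *m M).
Proof. by rewrite -quad_form_rel quad_form_lin_comb. Qed.

(** The coordinates in x_0^2, x_1^2, x_2^2 of the quadratic element with
    symmetric matrix B, modulo the relations. *)
Definition sqcoord e B : 'cV[k]_3 :=
  \col_m (B m m - e m * B (m + 1) (m + 2%:R)).

Lemma quad_form_sqcoord e B : (forall i, symm_rel x e i = 0) -> B^T = B ->
  quad_form x B = sum_sqs x (sqcoord e B).
Proof.
move=> H1 symB.
have BE : B = diag_mx (sqcoord e B)^T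
    + \sum_m B (m + 1) (m + 2%:R) *: rel_mx e m.
  have Bt i j : B i j = B j i by rewrite -{1}symB mxE.
  apply/matrixP=> i j; rewrite !mxE !sum_I3 !mxE !I3E.
  have B01 := Bt 0 1; have B02 := Bt 0 2%:R; have B12 := Bt 1 2%:R.
  elim/I3_ind: i; elim/I3_ind: j; rewrite ?I3E /= ?B01 ?B02 ?B12; by ring.
rewrite {1}BE quad_formD quad_form_diag quad_form_sum big1 ?addr0 // => m _.
by rewrite quad_formZ quad_form_rel H1 scaler0.
Qed.

Lemma rel_mx_partial M e i a b :
  (M^T *m rel_mx e i *m M) a b =
  cub_partial e i (M *m delta_mx a 0) (M *m delta_mx b 0).
Proof.
rewrite -!colE /cub_partial !mxE !sum_I3 !mxE !sum_I3 !mxE.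
by elim/I3_ind: i; rewrite ?I3E /=; ring.
Qed.

Lemma rel_presE e M :
  rel_pres e M <-> forall i, sqcoord e (M^T *m rel_mx e i *m M) = 0.
Proof.
split=> [H i|H i m].
  by apply/colP=> m; rewrite mxE !rel_mx_partial H subrr mxE.
have /colP/(_ m) := H i; rewrite mxE !rel_mx_partial [in RHS]mxE => /eqP.
by rewrite subr_eq0 => /eqP.
Qed.

Lemma sqcoord_diag e M v :
  sqcoord e (M^T *m diag_mx v^T *m M) = (sq_mx e M)^T *m v.
Proof.
by apply/colP=> m; rewrite !mxE !sum_I3 !mxE !sum_I3 !mxE /=; ring.
Qed.

Lemma tr_conj M B : B^T = B -> (M^T *m B *m M)^T = M^T *m B *m M.
Proof. by move=> symB; rewrite !trmx_mul trmxK symB mulmxA. Qed.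

Lemma rel_mx_sym e i : (rel_mx e i)^T = rel_mx e i.
Proof.
rewrite /rel_mx !linearD linearZ /= !trmx_delta; congr (_ + _).
exact: addrC.
Qed.

Lemma sum_sqs_sq_mx e M v : (forall i, symm_rel x e i = 0) ->
  sum_sqs (lin_comb M) v = sum_sqs x ((sq_mx e M)^T *m v).
Proof.
move=> H1; rewrite sum_sqs_lin_comb (quad_form_sqcoord H1) ?sqcoord_diag //.
by apply: tr_conj; rewrite tr_diag_mx.
Qed.

Lemma symm_rel_lin_comb_eq0 e M :
  (forall i, symm_rel x e i = 0) -> rel_pres e M ->
  forall i, symm_rel (lin_comb M) e i = 0.
Proof.
move=> H1 /rel_presE H i; rewrite symm_rel_lin_comb (quad_form_sqcoord H1) ?H.
  by apply: big1 => j _; rewrite mxE scale0r.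
by apply/tr_conj/rel_mx_sym.
Qed.

Lemma symm_rel_lin_comb_pres e M : (forall i, symm_rel x e i = 0) ->
  (forall v, sum_sqs x v = 0 -> v = 0) ->
  (forall i, symm_rel (lin_comb M) e i = 0) -> rel_pres e M.
Proof.
move=> H1 H2 H; apply/rel_presE => i; apply: H2.
rewrite -(quad_form_sqcoord H1) -?symm_rel_lin_comb ?H //.
exact/tr_conj/rel_mx_sym.
Qed.

Section Morphism.
Variables (e : 'I_3 -> k) (psi : {lrmorphism S -> S}) (M : 'M[k]_3).
Hypothesis H1 : forall i, symm_rel x e i = 0.
Hypothesis psiE : forall i, psi (x i) = lin_comb M i.

Lemma morphism_sum_sqs v : psi (sum_sqs x v) = sum_sqs x ((sq_mx e M)^T *m v).
Proof.
rewrite -sum_sqs_sq_mx // raddf_sum; apply: eq_bigr => i _.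
by rewrite /= linearZ rmorphXn /= psiE.
Qed.

Lemma morphism_rel_pres : (forall v, sum_sqs x v = 0 -> v = 0) -> rel_pres e M.
Proof.
move=> H2; apply: symm_rel_lin_comb_pres => // i.
have <- : psi (symm_rel x e i) = 0 by rewrite H1 raddf0.
by rewrite /symm_rel !raddfD /= linearZ rmorphXn !rmorphM /= !psiE.
Qed.
End Morphism.
End Quad.

(** * Coefficients of low degree and the free algebra *)

(* Morphisms from a quotient pi : A -> S, where r picks representatives. *)
Section Lift.
Variables (k : closedFieldType) (A S S' : lalgType k).
Variables (pi : {lrmorphism A -> S}) (r : S -> A) (f : {lrmorphism A -> S'}).
Hypothesis rK : forall q, pi (r q) = q.
Hypothesis f0 : forall p, pi p = 0 -> f p = 0.

Definition lift_fun q := f (r q).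

Lemma lift_funE p : lift_fun (pi p) = f p.
Proof.
apply/eqP; rewrite -subr_eq0 -raddfB; apply/eqP/f0.
by rewrite raddfB /= rK subrr.
Qed.

Lemma lift_fun_zmod : zmod_morphism lift_fun.
Proof. by move=> u v; rewrite -[u]rK -[v]rK -raddfB !lift_funE raddfB. Qed.

Lemma lift_fun_monoid : monoid_morphism lift_fun.
Proof.
split=> [|u v]; first by rewrite -(rmorph1 pi) lift_funE rmorph1.
by rewrite -[u]rK -[v]rK -rmorphM !lift_funE rmorphM.
Qed.

Lemma lift_fun_scalable : scalable lift_fun.
Proof. by move=> c u; rewrite -[u]rK -linearZ !lift_funE linearZ. Qed.

Lemma lift_lrmorphism :
  exists psi : {lrmorphism S -> S'}, forall p, psi (pi p) = f p.
Proof.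
pose ma := GRing.isZmodMorphism.Build _ _ lift_fun lift_fun_zmod.
pose mm := GRing.isMonoidMorphism.Build _ _ lift_fun lift_fun_monoid.
pose ms := GRing.isScalable.Build _ _ _ _ lift_fun lift_fun_scalable.
pose psi : {lrmorphism S -> S'} := HB.pack lift_fun ma mm ms.
by exists psi => p; apply: lift_funE.
Qed.
End Lift.

(** Functions behaving like the coefficients of degree 0, 1 and 2 of the
    noncommutative polynomials in x_0, x_1, x_2. *)
Record truncation (k : closedFieldType) (S : lalgType k) (x : 'I_3 -> S) :=
  Truncation {
  tcoef0 : S -> k;
  tcoef1 : 'I_3 -> S -> k;
  tcoef2 : 'I_3 -> 'I_3 -> S -> k;
  tcoef0D : forall p q, tcoef0 (p + q) = tcoef0 p + tcoef0 q;
  tcoef1D : forall i p q, tcoef1 i (p + q) = tcoef1 i p + tcoef1 i q;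
  tcoef2D : forall i j p q, tcoef2 i j (p + q) = tcoef2 i j p + tcoef2 i j q;
  tcoef0Z : forall a p, tcoef0 (a *: p) = a * tcoef0 p;
  tcoef1Z : forall i a p, tcoef1 i (a *: p) = a * tcoef1 i p;
  tcoef2Z : forall i j a p, tcoef2 i j (a *: p) = a * tcoef2 i j p;
  tcoef0M : forall p q, tcoef0 (p * q) = tcoef0 p * tcoef0 q;
  tcoef1M : forall i p q,
    tcoef1 i (p * q) = tcoef0 p * tcoef1 i q + tcoef1 i p * tcoef0 q;
  tcoef2M : forall i j p q,
    tcoef2 i j (p * q) =
    tcoef0 p * tcoef2 i j q + tcoef1 i p * tcoef1 j q + tcoef2 i j p * tcoef0 q;
  tcoef0x : forall j, tcoef0 (x j) = 0;
  tcoef1x : forall i j, tcoef1 i (x j) = (i == j)%:R;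
  tcoef2x : forall i j l, tcoef2 i j (x l) = 0
}.

Section TruncatedCoefs.
Variables (k : closedFieldType) (S : lalgType k) (x : 'I_3 -> S).
Variables (e : 'I_3 -> k) (T : truncation x).
Local Notation c0 := (tcoef0 T).
Local Notation c1 := (tcoef1 T).
Local Notation c2 := (tcoef2 T).

(** The conditions on the coefficients of degree at most 2 satisfied by the
    elements of the ideal generated by the relations. *)
Definition rel_trunc p := [/\ c0 p = 0, forall i, c1 i p = 0 &
  forall m, c2 m m p - e m * c2 (m + 1) (m + 2%:R) p = 0].

Lemma rel_truncD p q : rel_trunc p -> rel_trunc q -> rel_trunc (p + q).
Proof.
move=> [p0 p1 p2] [q0 q1 q2]; split=> [|i|m].
  by rewrite tcoef0D p0 q0 addr0.
  by rewrite tcoef1D p1 q1 addr0.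
by rewrite !tcoef2D mulrDr opprD addrACA p2 q2 addr0.
Qed.

Lemma rel_trunc0 : rel_trunc 0.
Proof.
rewrite -(scale0r (x 0)).
split=> [|i|m]; rewrite ?tcoef0Z ?tcoef1Z ?tcoef2Z ?mul0r //.
by rewrite mulr0 subr0.
Qed.

Lemma rel_trunc_rel i : rel_trunc (symm_rel x e i).
Proof.
split=> [|j|m].
- by rewrite /symm_rel expr2 !tcoef0D tcoef0Z !tcoef0M !tcoef0x; ring.
- by rewrite /symm_rel expr2 !tcoef1D tcoef1Z !tcoef1M !tcoef0x; ring.
- rewrite /symm_rel expr2 !tcoef2D !tcoef2Z !tcoef2M !tcoef0x !tcoef1x !tcoef2x.
  by elim/I3_ind: m; elim/I3_ind: i; rewrite ?I3E /=; ring.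
Qed.

Lemma rel_trunc_ideal a p b : rel_trunc p -> rel_trunc (a * p * b).
Proof.
move=> [p0 p1 p2]; split=> [|i|m].
- by rewrite !tcoef0M p0 mulr0 mul0r.
- by rewrite !tcoef1M !tcoef0M p0 p1; ring.
rewrite !tcoef2M !tcoef1M !tcoef0M p0 !p1.
transitivity (c0 a * c0 b * (c2 m m p - e m * c2 (m + 1) (m + 2%:R) p)).
  by ring.
by rewrite p2 mulr0.
Qed.

Lemma rel_trunc_lin v : rel_trunc (\sum_i v i *: x i) -> forall i, v i = 0.
Proof.
move=> [_ H _] i; rewrite -(H i) sum_I3 !tcoef1D !tcoef1Z !tcoef1x.
by elim/I3_ind: i => /=; ring.
Qed.

Lemma rel_trunc_sqs v : rel_trunc (sum_sqs x v) -> v = 0.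
Proof.
move=> [_ _ H]; apply/colP => m; rewrite mxE -(H m) /sum_sqs sum_I3 !expr2.
rewrite !tcoef2D !tcoef2Z !tcoef2M !tcoef0x !tcoef1x !tcoef2x.
by elim/I3_ind: m; rewrite ?I3E /=; ring.
Qed.
End TruncatedCoefs.

Section FreeAlgebra.
Variable k : closedFieldType.
Implicit Types (p q : freealg k).
Local Notation X := (fgen k).
Local Notation mon := {fmonom 'I_3}.

Lemma freealg_expand p : p = \sum_(m <- msupp p) p@_m *: << m >>.
Proof.
apply: (etrans (monalgE p)); apply: eq_bigr => m _.
apply/malgP => m'.
apply: (etrans (mcoeffU _ _ _)); apply: (etrans _ (esym (mcoeffZ _ _ _))).
by apply: (etrans (esym (mulr_natr _ _))); congr (_ * _); apply/esym/mcoeffU1.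
Qed.

Lemma monM (m m' : mon) : << mmul m m' >> = << m >> * << m' >> :> freealg k.
Proof. by apply: (etrans _ (esym (fgmulUU _ _ _ _))); rewrite mulr1. Qed.

Lemma mon_prod (m : mon) : << m >> = \prod_(i <- m : seq 'I_3) X i.
Proof.
case: m => s /=; elim: s => [|i s IHs].
  by rewrite big_nil; congr << _ >>; apply/eqP; rewrite fmP fm1.
rewrite big_cons -IHs -monM; congr << _ >>.
by apply/eqP; rewrite fmP fmM fmU.
Qed.

Lemma freealg_scalerAr c p q : p * (c *: q) = c *: (p * q).
Proof.
apply/malgP => m.
apply: (etrans (mcoeffMlw m (fsubset_refl (msupp p)) (msuppZ_le c q))).
apply: (etrans _ (esym (mcoeffZ c (p * q) m))).
apply: (etrans _ (esym (congr1 ( *%R c) (mcoeffMl p q m)))).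
rewrite mulr_sumr; apply: eq_bigr => m1 _.
rewrite mulr_sumr; apply: eq_bigr => m2 _.
rewrite mulrnAr; congr (_ *+ _).
apply: (etrans (congr1 ( *%R _) (mcoeffZ c q m2))).
exact: mulrCA.
Qed.

(** The coefficient of a product at m, with the indicator function of the
    factorizations of m replaced by h. *)
Lemma coefM_bilin (h : mon -> mon -> k) m p q :
  (forall m1 m2, (mmul m1 m2 == m)%:R = h m1 m2) ->
  (p * q)@_m =
  \sum_(m1 <- msupp p) \sum_(m2 <- msupp q) p@_m1 * q@_m2 * h m1 m2.
Proof.
move=> H; apply: (etrans (mcoeffMl p q m)).
by apply: eq_bigr => m1 _; apply: eq_bigr => m2 _; rewrite -H mulr_natr.
Qed.

Lemma coef_sum p m : p@_m = \sum_(m1 <- msupp p) p@_m1 * (m1 == m)%:R.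
Proof.
apply: (etrans (congr1 (mcoeff m) (freealg_expand p))).
apply: (etrans (raddf_sum (mcoeff m) _ _ _)); apply: eq_bigr => m1 _.
apply: (etrans (mcoeffZ _ _ _)); congr (_ * _); exact: mcoeffU1.
Qed.

Lemma coef_deg1M p q i :
  (p * q)@_(fmu i) =
  p@_(mone : mon) * q@_(fmu i) + p@_(fmu i) * q@_(mone : mon).
Proof.
rewrite (@coefM_bilin (fun m1 m2 => (m1 == mone)%:R * (m2 == fmu i)%:R
    + (m1 == fmu i)%:R * (m2 == mone)%:R)).
  rewrite [p@_mone]coef_sum [q@_(fmu i)]coef_sum.
  rewrite [p@_(fmu i)]coef_sum [q@_mone]coef_sum.
  rewrite !mulr_suml -big_split; apply: eq_bigr => m1 _.
  rewrite !mulr_sumr -big_split; apply: eq_bigr => m2 _ /=.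
  ring.
move=> [s1] [s2]; rewrite !fmP !fmM !fm1 !fmU /=.
case: s1 => [|a [|b s1]] /=; rewrite ?mul1r ?mul0r ?add0r ?addr0 //.
- by rewrite !eqseq_cons andbT -natrM mulnb.
- by rewrite !eqseq_cons /= !andbF mul0r.
Qed.

Lemma coef_deg2M p q i j : let ij := mmul (fmu i) (fmu j) in
  (p * q)@_ij = p@_(mone : mon) * q@_ij + p@_(fmu i) * q@_(fmu j)
                + p@_ij * q@_(mone : mon).
Proof.
move=> ij.
rewrite (@coefM_bilin (fun m1 m2 => (m1 == mone)%:R * (m2 == ij)%:R
    + (m1 == fmu i)%:R * (m2 == fmu j)%:R + (m1 == ij)%:R * (m2 == mone)%:R)).
  rewrite [p@_mone]coef_sum [q@_ij]coef_sum.
  rewrite [p@_(fmu i)]coef_sum [q@_mone]coef_sum.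
  rewrite [q@_(fmu j)]coef_sum [p@_ij]coef_sum.
  rewrite !mulr_suml -!big_split; apply: eq_bigr => m1 _.
  rewrite !mulr_sumr -!big_split; apply: eq_bigr => m2 _ /=.
  ring.
move=> [s1] [s2]; rewrite !fmP !fmM !fm1 !fmU /=.
case: s1 => [|a [|b [|c s1]]] /=;
  rewrite ?eqseq_cons ?mul1r ?mul0r ?add0r ?addr0 ?andbF ?mul0r //.
- by rewrite addr0 eqxx andbT -natrM mulnb.
- by rewrite add0r eqxx andbT -natrM mulnb andbA.
- by rewrite addr0.
Qed.

(** The universal property of the free algebra. *)
Lemma freealg_eval (S : lalgType k) (y : 'I_3 -> S) :
  (forall (c : k) (p q : S), p * (c *: q) = c *: (p * q)) ->
  exists f : {lrmorphism freealg k -> S}, forall i, f (X i) = y i.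
Proof.
move=> Ar.
pose h (m : mon) : S := \prod_(i <- m : seq 'I_3) y i.
have hM : mmorphism h.
  by split=> [m m'|]; rewrite /h ?fmM ?big_cat // fm1 big_nil.
pose hh : {mmorphism mon -> S} := HB.pack h (isMultiplicative.Build mon S h hM).
pose f := mmap (in_alg S) hh.
have fadd : zmod_morphism f by exact: mmap_is_additive.
have fmul : monoid_morphism f.
  have [|H1 H2] := @commr_mmap_is_multiplicative mon k S (in_alg S) hh;
    last by split.
  move=> g m m'; rewrite /GRing.comm /= mulr_algl.
  by rewrite -[LHS]mulr1 -scalerAl mulr1 Ar mulr1.
have fsc : scalable f.
  by move=> c p; apply: (etrans (mmapZ c p)); rewrite [LHS]mulr_algl.
pose ma := GRing.isZmodMorphism.Build _ _ f fadd.
pose mm := GRing.isMonoidMorphism.Build _ _ f fmul.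
pose ms := GRing.isScalable.Build _ _ _ _ f fsc.
pose ff : {lrmorphism freealg k -> S} := HB.pack f ma mm ms.
exists ff => i.
apply: (etrans (mmapU _ _)); rewrite /= scale1r mul1r /h.
by rewrite fmU big_seq1.
Qed.

Lemma freealg_lrmorphismE (S : lalgType k) (f : {lrmorphism freealg k -> S}) p :
  f p = \sum_(m <- msupp p) p@_m *: \prod_(i <- m : seq 'I_3) f (X i).
Proof.
apply: (etrans (congr1 f (freealg_expand p))).
apply: (etrans (raddf_sum f _ _ _)); apply: eq_bigr => m _.
apply: (etrans (linearZ _ _)); congr (_ *: _).
apply: (etrans (congr1 f (mon_prod m))).
exact: (etrans (rmorph_prod f _ _ _)).
Qed.

(** Homogeneous elements of degree n, including 0. *)
Definition homog n p := forall m : mon, p@_m != 0 -> fdeg m = n.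

Lemma homogD n p q : homog n p -> homog n q -> homog n (p + q).
Proof.
move=> hp hq m; have -> := mcoeffD m p q => nz.
have [p0|] := eqVneq p@_m 0; last exact: hp.
by apply: hq; move: nz; rewrite p0 add0r.
Qed.

Lemma homog0 n : homog n 0.
Proof.
move=> m; have -> : (0 : freealg k)@_m = 0 by exact: mcoeff0.
by rewrite eqxx.
Qed.

Lemma homogZ n c p : homog n p -> homog n (c *: p).
Proof.
move=> hp m; have -> := mcoeffZ c p m.
by rewrite mulf_eq0 negb_or => /andP[_ /hp].
Qed.

Lemma homogM n n' p q : homog n p -> homog n' q -> homog (n + n') (p * q).
Proof.
move=> hp hq m; have -> := mcoeff_neq0 (p * q) m.
move=> /msuppM_le[m1 [m2 [m1p m2q ->]]].
rewrite fdegM (hp m1) ?(hq m2) //.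
  by have -> := mcoeff_neq0 q m2.
by have -> := mcoeff_neq0 p m1.
Qed.

Lemma homog1 : homog 0 1.
Proof.
move=> m; have -> : (1 : freealg k)@_m = (m == mone)%:R by exact: mcoeff1.
have [->|_] := eqVneq m mone; first by rewrite fdeg1.
by rewrite eqxx.
Qed.

Lemma homog_fgen i : homog 1 (X i).
Proof.
move=> m; have -> : (X i)@_m = (fmu i == m)%:R by exact: mcoeffU1.
have [<-|_] := eqVneq (fmu i) m; first by rewrite fdegU.
by rewrite eqxx.
Qed.

Lemma homog1_lin p : homog 1 p -> p = \sum_i p@_(fmu i) *: X i.
Proof.
move=> hp; apply/malgP => m.
apply: (etrans _ (esym (raddf_sum (mcoeff m) _ _ _))) => /=.
transitivity (\sum_(i < 3) p@_(fmu i) * (fmu i == m)%:R); last first.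
  apply: eq_bigr => i _; apply: (etrans _ (esym (mcoeffZ _ _ _))).
  by congr (_ * _); apply/esym/mcoeffU1.
have [m1|m1] := eqVneq (fdeg m) 1%N.
  have [i ->] : exists i, m = fmu i.
    case: m m1 => [[|i [|//]]] // _; exists i.
    by apply/eqP; rewrite fmP fmU.
  rewrite (bigD1 i) //= eqxx mulr1 big1 ?addr0 // => j ne_ji.
  by rewrite fmP !fmU eqseq_cons andbT (negPf ne_ji) mulr0.
rewrite big1 => [|i _].
  by apply/eqP; apply: contraNT m1 => /hp ->.
case: eqP => [mE|_]; last by rewrite mulr0.
by move: m1; rewrite -mE fdegU.
Qed.

Definition freealg_truncation : truncation X.
Proof.
exists (mcoeff (mone : mon)) (fun i => mcoeff (fmu i))
  (fun i j => mcoeff (mmul (fmu i) (fmu j))).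
- by move=> p1 q1; exact: mcoeffD.
- by move=> i p1 q1; exact: mcoeffD.
- by move=> i j p1 q1; exact: mcoeffD.
- by move=> c p1; exact: mcoeffZ.
- by move=> i c p1; exact: mcoeffZ.
- by move=> i j c p1; exact: mcoeffZ.
- by move=> p1 q1; exact: (rmorphM (mcoeff (mone : mon))).
- by move=> i p1 q1; exact: coef_deg1M.
- by move=> i j p1 q1; exact: coef_deg2M.
- move=> j; have /= -> : (X j)@_(mone : mon) = (fmu j == mone)%:R.
    exact: mcoeffU1.
  by rewrite fm1_eq1.
- move=> i j; have /= -> : (X j)@_(fmu i) = (fmu j == fmu i)%:R.
    exact: mcoeffU1.
  by rewrite fmP !fmU eqseq_cons andbT eq_sym.
- move=> i j l.
  have /= -> : (X l)@_(mmul (fmu i) (fmu j)) =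
               (fmu l == mmul (fmu i) (fmu j))%:R.
    exact: mcoeffU1.
  by rewrite fmP fmM !fmU eqseq_cons andbF.
Qed.
End FreeAlgebra.

(** * Graded automorphisms of the algebra with the symmetric relations *)

(* The algebra S is the quotient pi of the free algebra by the ideal generated
   by the relations, and r picks representatives. *)
Section Presented.
Variables (k : closedFieldType) (S : lalgType k).
Variable pi : {lrmorphism freealg k -> S}.
Variables (r : S -> freealg k) (e : 'I_3 -> k).
Hypothesis rK : forall u, pi (r u) = u.
Hypothesis pi_rel : forall i, pi (symm_rel (fgen k) e i) = 0.
Hypothesis pi_ker : forall p, pi p = 0 ->
  exists s : seq (freealg k * 'I_3 * freealg k),
    p = \sum_(t <- s) t.1.1 * symm_rel (fgen k) e t.1.2 * t.2.
Hypothesis e_neq1 : e 0 * e 1 * e 2%:R != 1.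
Local Notation X := (fgen k).
Local Notation x := (fun i => pi (X i)).

(** Homogeneous elements of degree n of the quotient. *)
Definition degree n u := exists2 p, homog n p & u = pi p.

Lemma map_symm_rel (S' : lalgType k) (f : {lrmorphism freealg k -> S'}) i :
  f (symm_rel X e i) = symm_rel (fun j => f (X j)) e i.
Proof.
apply: (etrans (raddfD f _ _)); congr (_ + _).
  by apply: (etrans (raddfD f _ _)); congr (_ + _); exact: (rmorphM f).
by apply: (etrans (linearZ _ _)); congr (_ *: _); exact: (rmorphXn f).
Qed.

Lemma presented_scalerAr (c : k) (p q : S) : p * (c *: q) = c *: (p * q).
Proof.
rewrite -[p]rK -[q]rK -linearZ.
apply: (etrans (esym (rmorphM pi _ _))).
apply: (etrans (congr1 pi (freealg_scalerAr _ _ _))).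
by apply: (etrans (linearZ _ _)); congr (_ *: _); exact: (rmorphM pi).
Qed.

Lemma presented_rel i : symm_rel x e i = 0.
Proof. by rewrite -(map_symm_rel pi). Qed.

Lemma pi_ker_trunc p : pi p = 0 -> rel_trunc e (freealg_truncation k) p.
Proof.
move=> /pi_ker[s ->].
elim: s => [|t s IHs]; first by rewrite big_nil; exact: rel_trunc0.
rewrite big_cons; apply: rel_truncD IHs.
exact/rel_trunc_ideal/rel_trunc_rel.
Qed.

Lemma presented_lin_free (v : 'I_3 -> k) :
  \sum_j v j *: x j = 0 -> forall j, v j = 0.
Proof.
move=> H; apply: (@rel_trunc_lin _ _ _ e (freealg_truncation k)).
apply: pi_ker_trunc; rewrite -H.
apply: (etrans (raddf_sum pi _ _ _)); apply: eq_bigr => j _.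
exact: linearZ.
Qed.

Lemma presented_sqs_free v : sum_sqs x v = 0 -> v = 0.
Proof.
move=> H; apply: (@rel_trunc_sqs _ _ _ e (freealg_truncation k)).
apply: pi_ker_trunc; rewrite -H.
apply: (etrans (raddf_sum pi _ _ _)); apply: eq_bigr => j _.
by apply: (etrans (linearZ _ _)); congr (_ *: _); exact: (rmorphXn pi).
Qed.

Lemma presented_lrmorphism_eq (psi psi' : {lrmorphism S -> S}) :
  (forall i, psi (x i) = psi' (x i)) -> psi =1 psi'.
Proof.
move=> H u; rewrite -[u]rK.
have /= E1 := freealg_lrmorphismE (psi \o pi) (r u).
have /= E2 := freealg_lrmorphismE (psi' \o pi) (r u).
rewrite E1 E2; apply: eq_bigr => m _; congr (_ *: _).
by apply: eq_bigr => i _; exact: H.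
Qed.

Lemma degreeD n u w : degree n u -> degree n w -> degree n (u + w).
Proof.
move=> [p hp ->] [q hq ->]; exists (p + q); first exact: homogD.
by rewrite raddfD.
Qed.

Lemma degree0 n : degree n 0.
Proof. by exists 0; [exact: homog0|rewrite raddf0]. Qed.

Lemma degreeZ n c u : degree n u -> degree n (c *: u).
Proof.
move=> [p hp ->]; exists (c *: p); first exact: homogZ.
by rewrite linearZ.
Qed.

Lemma degreeM n m u w : degree n u -> degree m w -> degree (n + m) (u * w).
Proof.
move=> [p hp ->] [q hq ->]; exists (p * q); first exact: homogM.
by rewrite rmorphM.
Qed.

Lemma degree_one : degree 0 1.
Proof. by exists 1; [exact: homog1|rewrite rmorph1]. Qed.

Lemma degree_x i : degree 1 (x i).
Proof. by exists (X i) => //; exact: homog_fgen. Qed.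

Lemma degree1P u : degree 1 u <-> exists v : 'I_3 -> k, u = \sum_j v j *: x j.
Proof.
split=> [[p hp ->]|[v ->]].
  exists (fun j => p@_(fmu j)).
  apply: (etrans (congr1 pi (homog1_lin hp))).
  apply: (etrans (raddf_sum pi _ _ _)); apply: eq_bigr => j _.
  exact: linearZ.
rewrite sum_I3; apply: degreeD; [apply: degreeD|]; apply: degreeZ;
  exact: degree_x.
Qed.

Lemma degree_map (psi : {lrmorphism S -> S}) n u :
  (forall i, degree 1 (psi (x i))) -> degree n u -> degree n (psi u).
Proof.
move=> H [p hp ->].
have /= -> := freealg_lrmorphismE (psi \o pi) p.
rewrite big_seq; elim/big_ind: _ => [|v w|m mp].
- exact: degree0.
- exact: degreeD.
apply: degreeZ.
have <- : fdeg m = n by apply: hp; have -> := mcoeff_neq0 p m.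
rewrite fdegE; elim: (m : seq _) => [|i s IHs] /=.
  by rewrite big_nil; exact: degree_one.
by rewrite big_cons -add1n; exact: degreeM.
Qed.

Lemma matrix_of_iso (psi : {lrmorphism S -> S}) :
  bijective psi -> (forall n u, degree n u <-> degree n (psi u)) ->
  exists2 M, M \in unitmx & forall i, psi (x i) = lin_comb x M i.
Proof.
move=> [psi' psiK psi'K] deg.
have Hv i : exists v : 'I_3 -> k, psi (x i) = \sum_j v j *: x j.
  by apply/degree1P; rewrite -deg; exact: degree_x.
have Hw i : exists w : 'I_3 -> k, psi' (x i) = \sum_j w j *: x j.
  by apply/degree1P; rewrite deg psi'K; exact: degree_x.
have [v vE] := choice Hv; have [w wE] := choice Hw.
pose M : 'M[k]_3 := \matrix_(i, j) v i j.
pose W : 'M[k]_3 := \matrix_(i, j) w i j.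
have psiM i : psi (x i) = lin_comb x M i.
  by rewrite vE; apply: eq_bigr => j _; rewrite mxE.
exists M => //.
have psi'W i : psi' (x i) = lin_comb x W i.
  by rewrite wE; apply: eq_bigr => j _; rewrite mxE.
suff /mulmx1_unit[] : W *m M = 1%:M by [].
apply/matrixP=> i j; apply/eqP; rewrite -subr_eq0; apply/eqP.
apply: (presented_lin_free
  (v := fun j => (W *m M) i j - (1%:M : 'M[k]_3) i j)) => {j}.
under eq_bigr do rewrite scalerBl; rewrite sumrB.
apply/eqP; rewrite subr_eq0; apply/eqP.
rewrite -[LHS]/(lin_comb x (W *m M) i) -[RHS]/(lin_comb x 1%:M i).
rewrite lin_comb1 lin_comb_mulmx.
rewrite -[RHS]psi'K psi'W raddf_sum; apply: eq_bigr => j _.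
by rewrite /= linearZ /= psiM.
Qed.

Lemma iso_cub_aut (psi : {lrmorphism S -> S}) M : M \in unitmx ->
  (forall i, psi (x i) = lin_comb x M i) -> cub_aut e M.
Proof.
move=> uM psiM; split=> //; apply: rel_pres_cub_map e_neq1 _.
exact: (morphism_rel_pres presented_scalerAr presented_rel psiM
          presented_sqs_free).
Qed.

Lemma lift_of_cub_aut M : cub_aut e M ->
  exists psi : {lrmorphism S -> S}, forall i, psi (x i) = lin_comb x M i.
Proof.
move=> [uM [l /(cub_map_rel_pres uM) relM]].
have [f fX] := freealg_eval (lin_comb x M) presented_scalerAr.
have [|psi psiE] := @lift_lrmorphism _ _ _ _ pi r f rK.
  move=> p /pi_ker[s ->].
  apply: (etrans (raddf_sum f _ _ _)); apply: big1 => t _.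
  transitivity (f t.1.1 * symm_rel (fun j => f (X j)) e t.1.2 * f t.2).
    apply: (etrans (rmorphM f _ _)); congr (_ * _).
    by apply: (etrans (rmorphM f _ _)); congr (_ * _); exact: map_symm_rel.
  suff -> : symm_rel (fun j => f (X j)) e t.1.2 = 0 by rewrite mulr0 mul0r.
  rewrite -(symm_rel_lin_comb_eq0 presented_scalerAr presented_rel relM t.1.2).
  by rewrite /symm_rel !fX.
by exists psi => i; rewrite psiE fX.
Qed.

Lemma iso_of_cub_aut M : cub_aut e M ->
  exists psi : {lrmorphism S -> S},
    [/\ bijective psi, forall n u, degree n u <-> degree n (psi u) &
        forall i, psi (x i) = lin_comb x M i].
Proof.
move=> autM; have [uM _] := autM.
have [psi psiM] := lift_of_cub_aut autM.
have [psi' psiM'] := lift_of_cub_aut (cub_aut_inv autM).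
have deg1 N (f : {lrmorphism S -> S}) :
    (forall i, f (x i) = lin_comb x N i) ->
    forall n u, degree n u -> degree n (f u).
  move=> fN n u; apply: degree_map => i; rewrite fN; apply/degree1P.
  by exists (N i).
have comp N N' (f f' : {lrmorphism S -> S}) :
    (forall i, f (x i) = lin_comb x N i) ->
    (forall i, f' (x i) = lin_comb x N' i) -> N *m N' = 1%:M -> cancel f f'.
  move=> fN fN' NN'.
  apply: (presented_lrmorphism_eq (psi := f' \o f) (psi' := idfun)) => i /=.
  rewrite fN; transitivity (lin_comb x 1%:M i); last exact: (lin_comb1 x).
  rewrite -NN' lin_comb_mulmx raddf_sum.
  by apply: eq_bigr => j _; rewrite /= linearZ /= fN'.
have psiK := comp _ _ _ _ psiM psiM' (mulmxV uM).
have psi'K := comp _ _ _ _ psiM' psiM (mulVmx uM).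
exists psi; split=> //; first by exists psi'.
move=> n u; split; first exact: (deg1 _ _ psiM).
by rewrite -{2}[u]psiK; exact: (deg1 _ _ psiM').
Qed.
End Presented.

(** * The four families *)

Section Relations.
Variables (k : closedFieldType) (S : lalgType k) (y : 'I_3 -> S).

Let rels e := [:: symm_rel y e 2%:R; symm_rel y e 0; symm_rel y e 1].

Lemma rels_S : rels (vec3 0 0 0) =
  [:: y 0 * y 1 + y 1 * y 0; y 1 * y 2%:R + y 2%:R * y 1;
      y 2%:R * y 0 + y 0 * y 2%:R].
Proof. by rewrite /rels /symm_rel !I3E /vec3 /= !scale0r !addr0. Qed.

Lemma rels_S' : rels (vec3 1 0 0) =
  [:: y 0 * y 1 + y 1 * y 0; y 1 * y 2%:R + y 2%:R * y 1 + y 0 ^+ 2;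
      y 2%:R * y 0 + y 0 * y 2%:R].
Proof. by rewrite /rels /symm_rel !I3E /vec3 /= !scale0r !addr0 scale1r. Qed.

Lemma rels_N : rels (vec3 1 1 0) =
  [:: y 0 * y 1 + y 1 * y 0; y 1 * y 2%:R + y 2%:R * y 1 + y 0 ^+ 2;
      y 2%:R * y 0 + y 0 * y 2%:R + y 1 ^+ 2].
Proof. by rewrite /rels /symm_rel !I3E /vec3 /= scale0r addr0 !scale1r. Qed.

Lemma rels_E xi : rels (fun=> xi) =
  [:: y 0 * y 1 + y 1 * y 0 + xi *: y 2%:R ^+ 2;
      y 1 * y 2%:R + y 2%:R * y 1 + xi *: y 0 ^+ 2;
      y 2%:R * y 0 + y 0 * y 2%:R + xi *: y 1 ^+ 2].
Proof. by rewrite /rels /symm_rel !I3E. Qed.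
End Relations.

Section Main.
Variable k : closedFieldType.
Hypothesis char0 : [pchar k] =i pred0.

(** The coefficients of the squares in the relations of the algebra K. *)
Definition symm_coef (K : symm_kind k) : 'I_3 -> k :=
  match K with
  | kind_S => vec3 0 0 0
  | kind_S' => vec3 1 0 0
  | kind_N => vec3 1 1 0
  | kind_E xi _ => fun=> xi
  end.

Lemma symm_relsE (K : symm_kind k) : symm_rels K =
  [:: symm_rel (fgen k) (symm_coef K) 2%:R;
      symm_rel (fgen k) (symm_coef K) 0;
      symm_rel (fgen k) (symm_coef K) 1].
Proof.
case: K => [|||xi adm].
- exact: esym (rels_S (fgen k)).
- exact: esym (rels_S' (fgen k)).
- exact: esym (rels_N (fgen k)).
- exact: esym (rels_E (fgen k) xi).
Qed.

(** xi^3 + 8 = (xi + 2) ((xi - 1)^2 + 3). *)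
Lemma admissible_cube xi : admissible xi -> xi ^+ 3 + 8%:R != 0 :> k.
Proof.
case=> _ xi2 xis _.
have -> : xi ^+ 3 + 8%:R = (xi + 2%:R) * ((xi - 1) ^+ 2 + 3%:R) by ring.
rewrite mulf_neq0 // ?addr_eq0 //; apply/eqP => /(xis (xi - 1))[].
by rewrite addrC subrK eqxx.
Qed.

Lemma symm_coef_neq1 K : symm_coef K 0 * symm_coef K 1 * symm_coef K 2%:R != 1.
Proof.
case: K => [|||xi [_ _ _ xi3]] /=.
1-3: by rewrite /vec3 /= mulr0 eq_sym oner_eq0.
by rewrite -expr2 -exprSr.
Qed.

(** The map M |-> (sq_mx e M)^T sends the group of [cub_aut] matrices onto
    itself. *)
Lemma sq_mx_aut K M : cub_aut (symm_coef K) M <->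
    exists2 M', cub_aut (symm_coef K) M' & (sq_mx (symm_coef K) M')^T = M.
Proof.
case: K => [|||xi adm] /=;
  [exact: sq_mx_aut_S|exact: sq_mx_aut_S'|exact: sq_mx_aut_N|].
have x8 := admissible_cube adm; case: adm => x0 _ _ x3.
exact: sq_mx_aut_scalar.
Qed.

Section Algebra.
Variable K : symm_kind k.
Local Notation e := (symm_coef K).
Local Notation rels := (symm_rels K).

Definition srepr (u : symm_alg K) : freealg k := @qrepr _ _ rels u.

Lemma sreprK u : sproj K (srepr u) = u.
Proof. exact: qreprK. Qed.

Lemma sproj_rel i : sproj K (symm_rel (fgen k) e i) = 0.
Proof.
suff : in_ideal rels (symm_rel (fgen k) e i).
  move=> /idealP Hi; apply/eqP.
  by have := qproj_eq rels (symm_rel (fgen k) e i) 0; rewrite subr0 Hi raddf0.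
have [j <-] : exists j : 'I_(size rels), rels`_j = symm_rel (fgen k) e i.
  rewrite symm_relsE.
  elim/I3_ind: i; [by exists 1|by exists 2%:R|by exists 0].
by exists [:: (1, j, 1)]; rewrite big_seq1 mul1r mulr1.
Qed.

Lemma sproj_ker p : sproj K p = 0 ->
  exists s : seq (freealg k * 'I_3 * freealg k),
    p = \sum_(t <- s) t.1.1 * symm_rel (fgen k) e t.1.2 * t.2.
Proof.
move=> /eqP p0.
have /idealP[s ->] : p \in ideal rels.
  by have := qproj_eq rels p 0; rewrite subr0 raddf0 => <-.
have relj (j : 'I_(size rels)) : exists i, rels`_j = symm_rel (fgen k) e i.
  case: j => j /=; rewrite symm_relsE; case: j => [|[|[|//]]] _ /=.
  - by exists 2%:R. - by exists 0. - by exists 1.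
have [c cE] := choice relj.
exists [seq (t.1.1, c t.1.2, t.2) | t <- s].
by rewrite big_map; apply: eq_bigr => t _ /=; rewrite cE.
Qed.

Lemma graded_iso_matrix (psi : {lrmorphism symm_alg K -> symm_alg K}) :
  graded_iso psi -> exists2 M, cub_aut e M & gr_matrix psi M.
Proof.
move=> [bij deg].
have [M uM psiM] := matrix_of_iso (pi := sproj K) sproj_ker bij deg.
exists M => //.
exact: (iso_cub_aut sreprK sproj_rel sproj_ker (symm_coef_neq1 K) uM psiM).
Qed.

Lemma matrix_graded_iso M : cub_aut e M ->
  exists2 psi : {lrmorphism symm_alg K -> symm_alg K},
    graded_iso psi & gr_matrix psi M.
Proof.
move=> autM.
have [psi [bij deg psiM]] := iso_of_cub_aut sreprK sproj_rel sproj_ker autM.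
by exists psi.
Qed.

Lemma gr_matrix_sum_sq (psi : {lrmorphism symm_alg K -> symm_alg K}) M v :
  gr_matrix psi M -> psi (sum_sq K v) = sum_sq K ((sq_mx e M)^T *m v).
Proof.
move=> psiM.
exact: (morphism_sum_sqs (presented_scalerAr sreprK)
          (presented_rel sproj_rel) psiM).
Qed.

Lemma gr_matrix_inj (psi : {lrmorphism symm_alg K -> symm_alg K}) M M' :
  gr_matrix psi M -> gr_matrix psi M' -> M = M'.
Proof.
move=> psiM psiM'; apply/matrixP => i j; apply/eqP.
rewrite -subr_eq0; apply/eqP.
move: j; apply: (presented_lin_free sproj_ker (v := fun j => M i j - M' i j)).
transitivity (psi (gen K i) - psi (gen K i)); last exact: subrr.
rewrite {1}psiM psiM' -sumrB; apply: eq_bigr => j _; exact: scalerBl.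
Qed.

Lemma sum_sq_inj : injective (sum_sq K).
Proof.
move=> v w vw; apply/eqP; rewrite -subr_eq0; apply/eqP.
apply: (presented_sqs_free sproj_ker).
apply: (etrans (sum_sqsB (fun i => sproj K (fgen k i)) v w)).
apply: (etrans (congr1 (fun u => u - sum_sq K w) vw)).
exact: subrr.
Qed.
End Algebra.
End Main.

Theorem theorem4p5 (k : closedFieldType) (char0 : [pchar k] =i pred0)
    (K : symm_kind k) (v v' : 'cV[k]_3) (v_neq0 : v != 0) (v'_neq0 : v' != 0) :
  pair_iso (sum_sq K v) (sum_sq K v') <->
  exists (phi : {lrmorphism symm_alg K -> symm_alg K}) (M : 'M[k]_3),
    [/\ graded_iso phi, gr_matrix phi M & v' = M *m v].
Proof.
split=> [[psi isopsi psiv]|[phi [M [isophi phiM v'E]]]].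
  have [M autM psiM] := graded_iso_matrix isopsi.
  move: psiv; rewrite (gr_matrix_sum_sq _ psiM) => /sum_sq_inj v'E.
  have autN : cub_aut (symm_coef K) (sq_mx (symm_coef K) M)^T.
    by apply/(sq_mx_aut char0); exists M.
  have [phi isophi phiN] := matrix_graded_iso autN.
  by exists phi, (sq_mx (symm_coef K) M)^T.
have [M1 autM phiM1] := graded_iso_matrix isophi.
have EM := gr_matrix_inj phiM1 phiM; rewrite {M1 phiM1}EM in autM.
have [M' autM' EM] := (sq_mx_aut char0 K M).1 autM.
have [psi isopsi psiM'] := matrix_graded_iso autM'.
by exists psi => //; rewrite (gr_matrix_sum_sq _ psiM') EM v'E.
Qed.
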